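(* For integers $k,n\ge1$ pick $\sigma$ uniformly in $S_k^n\rtimes S_n$ and let $a_i(\sigma)$ be the number of $i$-cycles of $\sigma$ (set $a_i=0$ for $i>kn$). Then as $k,n\to\infty$ (jointly, in any manner), the joint law of $(a_i(\sigma))_{i\ge1}$ converges weakly (in the sense of finite-dimensional distributions) to the law of $(A_i)_{i\ge1}$, where $$A_i=\sum_{l\mid i}\ \sum_{r=1}^{N_l} Z^{(l,r)}_{i/l}=\sum_{l\mid i}\sum_{j\ge1} j\,X_{l,i/l,j},$$ with $N_l$, $Z^{(l,r)}$, $X_{l,q,j}$ as in the context. In particular, for fixed $l,q$ the variables $(X_{l,q,j})_{j\ge1}$ are independent with $X_{l,q,j}\sim\mathrm{Poi}(p^{q}_j/l)$, where $p^q_j=e^{-1/q}(1/q)^j/j!$, and the families indexed by different $l$ are independent. Consequently $$\mathbb E[A_i]=\frac{\sigma_0(i)}{i},\qquad \operatorname{Var}(A_i)=\frac{\sigma_0(i)}{i}+\frac1i\sum_{l\mid i}\frac1l,$$ where $\sigma_0(i)$ is the number of divisors of $i$.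
   Context: Wreath product: $\sigma=(g_1,\dots,g_n;h)$ with $g_i\in S_k$, $h\in S_n$ acts on $\{1,\dots,kn\}$ by $(i-1)k+r\mapsto(h(i)-1)k+g_i(r)$. Limit objects: $(N_l)_{l\ge1}$ independent with $N_l\sim\mathrm{Poi}(1/l)$; independently, $\{Z^{(l,r)}\}_{l,r\ge1}$ iid copies of a sequence $Z=(Z_1,Z_2,\dots)$ of independent random variables with $Z_q\sim\mathrm{Poi}(1/q)$; and $X_{l,q,j}=\#\{1\le r\le N_l: Z^{(l,r)}_q=j\}$. *)

(* Defs.v *)
From HB Require Import structures.
From mathcomp Require Import all_boot all_order all_algebra all_fingroup.
From mathcomp Require Import all_classical all_reals all_analysis.

Set Implicit Arguments.
Unset Strict Implicit.
Unset Printing Implicit Defensive.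

Import Order.TTheory GRing.Theory Num.Theory.
Local Open Scope classical_set_scope.
Local Open Scope ring_scope.

(* Point (i-1)k + r  (1<=i<=n, 1<=r<=k) is encoded as the pair (i,r)    *)
(* in 'I_n * 'I_k (0-based); sigma = (g_1..g_n; h) maps it to           *)
(* (h(i), g_i(r)), i.e. (h(i)-1)k + g_i(r).                             *)

Definition wreath_elt (k n : nat) : finType :=
  ({ffun 'I_n -> {perm 'I_k}} * {perm 'I_n})%type.

Definition wreath_fun (k n : nat) (x : wreath_elt k n) (p : 'I_n * 'I_k)
  : 'I_n * 'I_k := (x.2 p.1, x.1 p.1 p.2).

Lemma wreath_fun_inj (k n : nat) (x : wreath_elt k n) :
  injective (wreath_fun x).
Proof.
move=> [i r] [i' r'] [] /perm_inj Hi; rewrite /= {}Hi => /perm_inj ->.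
by [].
Qed.

Definition wreath_perm (k n : nat) (x : wreath_elt k n) : {perm 'I_n * 'I_k} :=
  perm (@wreath_fun_inj k n x).

Definition cycle_count (T : finType) (s : {perm T}) (i : nat) : nat :=
  #|[set C in porbits s | #|C| == i]|.

Definition wreath_prob {R : realType} (k n m : nat) (c : nat -> nat) : R :=
  (#|[set x : wreath_elt k n |
       [forall i : 'I_m, cycle_count (wreath_perm x) i.+1 == c i.+1]]|)%:R
  / (#|wreath_elt k n|)%:R.

Section prob.
Context {d : measure_display} {T : measurableType d} {R : realType}.
Variable P : probability T R.

Definition nat_rv (X : T -> nat) := forall v : nat, measurable [set t | X t = v].

Definition poisson_law (X : T -> nat) (rate : R) :=
  nat_rv X /\ forall v : nat, P [set t | X t = v] = (poisson_pmf rate v)%:E.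

Definition mutually_independent (I : eqType) (D : pred I) (X : I -> T -> nat) :=
  (forall i, D i -> nat_rv (X i)) /\
  forall (s : seq I) (v : I -> nat), uniq s -> all D s ->
    P (\big[setI/setT]_(i <- s) [set t | X i t = v i])
    = (\prod_(i <- s) P [set t | X i t = v i])%E.

(* Independence of the families (Y l _)_{l in DI}, each family being
   (Y l p)_{p in DJ}: the sigma-algebras generated by the families are
   independent (checked on the generating pi-systems of cylinder events). *)
Definition independent_families (I J : eqType) (DI : pred I) (DJ : pred J)
    (Y : I -> J -> T -> nat) :=
  forall (L : seq I) (S : I -> seq J) (v : I -> J -> nat),
    uniq L -> all DI L -> (forall l, all DJ (S l)) ->
    P (\big[setI/setT]_(l <- L) \big[setI/setT]_(p <- S l)
          [set t | Y l p t = v l p])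
    = (\prod_(l <- L) P (\big[setI/setT]_(p <- S l) [set t | Y l p t = v l p]))%E.

End prob.

Definition limit_index := (nat + (nat * nat * nat))%type.

Definition limit_index_ok : pred limit_index := fun i =>
  match i with
  | inl l => 0 < l
  | inr (l, r, q) => [&& 0 < l, 0 < r & 0 < q]
  end%N.

Definition limit_family {T : Type} (N : nat -> T -> nat)
    (Z : nat -> nat -> nat -> T -> nat) : limit_index -> T -> nat :=
  fun i => match i with inl l => N l | inr (l, r, q) => Z l r q end.

Definition Xlim {T : Type} (N : nat -> T -> nat) (Z : nat -> nat -> nat -> T -> nat)
    (l q j : nat) (t : T) : nat :=
  (\sum_(1 <= r < (N l t).+1) (Z l r q t == j))%N.

Definition Alim {T : Type} (N : nat -> T -> nat) (Z : nat -> nat -> nat -> T -> nat)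
    (i : nat) (t : T) : nat :=
  (\sum_(l <- divisors i) \sum_(1 <= r < (N l t).+1) Z l r (i %/ l)%N t)%N.

Definition pqj {R : realType} (q j : nat) : R :=
  expR (- (q%:R)^-1) * (q%:R)^-1 ^+ j / (j`!)%:R.

Definition sigma0 (i : nat) : nat := size (divisors i).

(* Main.v *)
(** Everything is reduced to generating functions.

    Give each point [(i, r)] the weight [w i] of its block and weigh an element of
    the wreath product by the product of [s (w C)] over its cycles [C].  Removing
    one block, whose weight is passed on to its successor, gives a recursion on the
    number of blocks; for unit weights it collapses to
    [(n+1) E_(n+1) = \sum_(1 <= l <= n+1) f_l E_(n+1-l)], where [f_l] is the average
    over [S_k] of [\prod_C s (l |C|)].  When [f_l = 1] for [l > m], the solution
    tends to [exp (\sum_(l <= m) (f_l - 1) / l)] uniformly in [f], by induction on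
    [m].  The case [k = 1] gives the limit of [f_l] itself.  Hence
    [E (\prod_i s_i ^ (a_i))] tends to an iterated exponential, which is also the
    generating function of the [A_i]: condition on the [N_l] and use independence.

    A functional of bounded functions of several natural variables, affine in each
    of them, is determined on indicators by its values on powers, and this passes to
    limits.  This turns generating functions into finite-dimensional laws, both for
    the limit theorem and for the joint law and the independence of the [X_(l,q,j)].
    The moments come from the expansion of the generating function at [1]. *)
Require Import Defs.
From HB Require Import structures.
From mathcomp Require Import all_boot all_order all_algebra all_fingroup.
From mathcomp Require Import all_classical all_reals all_analysis measurable_realfun.
From mathcomp Require Import ring lra zify.

Set Implicit Arguments.
Unset Strict Implicit.
Unset Printing Implicit Defensive.

Import Order.TTheory GRing.Theory Num.Theory.
Import numFieldNormedType.Exports.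
Local Open Scope ring_scope.

(** * Weighted cycle products and insertion of a block *)

(** Unit weights are not preserved when a block is removed, because its successor becomes heavier.
    Arbitrary weights close the recursion, and from unit weights only one heavier block ever has to
    be followed. The obstacle in the limit is that the averages [f_l] depend on [k], while no
    relation between [k] and [n] is assumed: a threshold for [n] that serves all [f] with values in
    [[0,1]] at once separates the two limits. Taking [s = 1] beyond [m] forces [f_l = 1] beyond [m],
    so only finitely many coefficients vary. Test functions have values in [[0,1]] throughout, so
    every product is integrable without moment assumptions. Generating functions are therefore only
    evaluated on [[0,1]], and the moments are reached by letting the argument increase to [1]. *)

Section CycleProduct.
Variables (R : comNzRingType) (s : nat -> R).

Definition cycle_prod (X : finType) (u : {perm X}) (w : X -> nat) : R :=
  \prod_(C in porbits u) s (\sum_(x in C) w x)%N.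

(* [rho] may contract a cycle, in which case weights are added up. *)
Lemma cycle_prod_retract (X Y : finType) (u : {perm X}) (v : {perm Y})
    (rho : X -> Y) (io : Y -> X) (w : X -> nat) (w' : Y -> nat) :
  cancel io rho ->
  (forall x, io (rho x) \in porbit u x) ->
  (forall x, rho (u x) \in porbit v (rho x)) ->
  (forall y, io (v y) \in porbit u (io y)) ->
  (forall y, w' y = \sum_(x | rho x == y) w x)%N ->
  cycle_prod u w = cycle_prod v w'.
Proof.
move=> ioK iorho rhou iov ww'.
have rhoP x x' : x' \in porbit u x -> rho x' \in porbit v (rho x).
  case/porbitP => i ->; elim: i => [|i]; first by rewrite expg0 perm1 porbit_id.
  rewrite -eq_porbit_mem => /eqP <-; rewrite expgSr permM; exact: rhou.
have ioP y y' : y' \in porbit v y -> io y' \in porbit u (io y).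
  case/porbitP => i ->; elim: i => [|i]; first by rewrite expg0 perm1 porbit_id.
  rewrite -eq_porbit_mem => /eqP <-; rewrite expgSr permM; exact: iov.
(* [rho] separates cycles because [io (rho x)] stays on the cycle of [x]; hence [rho] induces a
   bijection between the cycles of [u] and those of [v]. *)
have eqP2 x x' : (rho x' \in porbit v (rho x)) = (x' \in porbit u x).
  apply/idP/idP; last exact: rhoP.
  move/ioP; move: (iorho x) (iorho x'); rewrite -!eq_porbit_mem.
  by move=> /eqP <- /eqP <-.
have im x : rho @: porbit u x = porbit v (rho x).
  apply/setP => y; apply/imsetP/idP => [[x' x'x ->]|]; first by rewrite eqP2.
  by move=> yx; exists (io y); rewrite ?ioK // -eqP2 ioK.
rewrite /cycle_prod.
have -> : porbits v = [set rho @: C | C : {set X} in porbits u].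
  apply/setP => D; apply/idP/idP => /imsetP[].
    by move=> y _ ->; apply/imsetP; exists (porbit u (io y)); rewrite ?im ?ioK // imset_f.
  by move=> C /imsetP[x _ ->] ->; rewrite im imset_f.
rewrite [RHS]big_imset /=; last first.
  move=> _ _ /imsetP[x _ ->] /imsetP[x' _ ->]; rewrite !im => /eqP.
  by rewrite eq_porbit_mem eqP2 -eq_porbit_mem => /eqP.
apply: eq_bigr => C /imsetP[x _ ->]; rewrite im; congr s.
rewrite (eq_bigr (fun y => \sum_(x' | rho x' == y) w x')%N) => [|y _]; last exact: ww'.
rewrite (exchange_big_dep (fun x' => x' \in porbit u x)) /=; last first.
  by move=> y x' yx /eqP x'y; rewrite -eqP2 x'y.
apply: eq_bigr => x' x'x; rewrite (big_pred1 (rho x')) // => y /=.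
rewrite [RHS]eq_sym.
by case: eqP => [<-|_]; rewrite ?andbF // eqP2 x'x.
Qed.

Lemma porbit_intertwine (A X : finType) (a : A -> X) (f : {perm A}) (u : {perm X}) y :
  (forall y, a (f y) = u (a y)) -> porbit u (a y) = a @: porbit f y.
Proof.
move=> au.
have aui i z : a ((f ^+ i)%g z) = (u ^+ i)%g (a z).
  by elim: i => [|i IH]; rewrite ?expg0 ?perm1 // !expgSr !permM au IH.
apply/setP => x; apply/porbitP/imsetP => [[i ->]|[z /porbitP[i ->] ->]].
  by exists ((f ^+ i)%g y); rewrite ?aui ?mem_porbit.
by exists i; rewrite aui.
Qed.

(** The images of [a] and [b] are complementary [u]-invariant sets, so every cycle of [u] lies in
    exactly one of them. This covers the insertion of a block as a fixed block. *)
Lemma cycle_prod_sum (A B X : finType) (a : A -> X) (b : B -> X)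
    (f : {perm A}) (g : {perm B}) (u : {perm X}) (w : X -> nat) :
  injective a -> injective b -> (forall y z, a y != b z) ->
  (forall x, (exists y, x = a y) \/ (exists z, x = b z)) ->
  (forall y, a (f y) = u (a y)) -> (forall z, b (g z) = u (b z)) ->
  cycle_prod u w = cycle_prod f (w \o a) * cycle_prod g (w \o b).
Proof.
move=> aI bI ab abX au bu; rewrite /cycle_prod.
have imE (A' : finType) (a' : A' -> X) (f' : {perm A'}) : injective a' ->
    \prod_(C in porbits f') s (\sum_(x in C) (w \o a') x)%N =
    \prod_(C in [set a' @: C | C : {set A'} in porbits f']) s (\sum_(x in C) w x)%N.
  move=> a'I; rewrite [RHS]big_imset /=; last by move=> C D _ _; exact: imset_inj.
  by apply: eq_bigr => C _; rewrite big_imset //= => x y _ _; exact: a'I.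
rewrite (imE _ a) // (imE _ b) // -bigU /=; last first.
  rewrite disjoint_sym; apply/pred0P => C /=; apply/negP => /andP[].
  case/imsetP => _ /imsetP[z _ ->] -> /imsetP[_ /imsetP[y _ ->]] /setP/(_ (b z)).
  rewrite imset_f ?porbit_id // => /esym/imsetP[y' _ E].
  by move: (ab y' z); rewrite E eqxx.
apply: eq_bigl => C; rewrite inE; apply/idP/orP => [/imsetP[x _ ->]|].
  case: (abX x) => -[y ->]; [left|right].
    by rewrite (porbit_intertwine _ au) imset_f // imset_f.
  by rewrite (porbit_intertwine _ bu) imset_f // imset_f.
by case=> /imsetP[_ /imsetP[y _ ->] ->];
  rewrite -?(porbit_intertwine _ au) -?(porbit_intertwine _ bu) imset_f.
Qed.

End CycleProduct.

Lemma cycle_prod_scale (R : comNzRingType) (s : nat -> R) (X : finType) (u : {perm X})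
    (w : X -> nat) a :
  cycle_prod s u (fun x => a * w x)%N = cycle_prod (fun l => s (a * l)%N) u w.
Proof. by apply: eq_bigr => C _; rewrite big_distrr. Qed.

Section WreathExtension.
Variables (k n : nat) (p : 'I_n.+1).
Implicit Types (x : wreath_elt k n) (j : 'I_n.+1) (q : {perm 'I_k}).

(* Inserts block [p] just before block [j] in a cycle of the block permutation
   (or as a new fixed block if [j = p]); dividing by [q] on entering [p] leaves
   the cycle products of the other blocks unchanged. *)
Definition wreath_ext q j x : wreath_elt k n.+1 :=
  ([ffun i => if unlift p i is Some i' then
      if lift p (x.2 i') == j then (x.1 i' * q^-1)%g else x.1 i'
    else q], (lift_perm p p x.2 * tperm p j)%g).

Lemma wreath_ext_pivot q j x r : wreath_perm (wreath_ext q j x) (p, r) = (j, q r).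
Proof.
by rewrite permE /wreath_fun /= ffunE unlift_none permM lift_perm_id tpermL.
Qed.

Lemma wreath_ext_lift q j x i r : wreath_perm (wreath_ext q j x) (lift p i, r) =
  if lift p (x.2 i) == j then (p, q^-1%g (x.1 i r)) else (lift p (x.2 i), x.1 i r).
Proof.
rewrite permE /wreath_fun /= ffunE liftK permM lift_perm_lift.
case: eqP => [->|/eqP ne]; first by rewrite tpermR permM.
by rewrite tpermD ?neq_lift // eq_sym.
Qed.

Lemma wreath_ext_inj :
  injective (fun y : {perm 'I_k} * 'I_n.+1 * wreath_elt k n =>
               wreath_ext y.1.1 y.1.2 y.2).
Proof.
move=> [[q j] x] [[q' j'] x'] /= [E1 E2].
have Ej : j = j'.
  by move/permP/(_ p): E2; rewrite !permM !lift_perm_id !tpermL.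
have Eg : q = q' by move/ffunP/(_ p): E1; rewrite !ffunE unlift_none.
subst q' j'; congr (_, _); move/mulIg: E2 => E2.
have E3 : x.2 = x'.2.
  apply/permP => i; apply: (@lift_inj _ p).
  by rewrite -!(lift_perm_lift p p) E2.
case: x x' E1 E3 {E2} => [g h] [g' h'] /= E1 E3; subst h'; congr (_, _).
apply/ffunP => i; move/ffunP/(_ (lift p i)): E1; rewrite !ffunE liftK.
by case: ifP => // _ /mulIg.
Qed.

(** Injectivity and a count: $k!\,(n+1)\cdot k!^n\,n! = k!^{n+1}(n+1)!$. *)
Lemma wreath_ext_bij :
  bijective (fun y : {perm 'I_k} * 'I_n.+1 * wreath_elt k n =>
               wreath_ext y.1.1 y.1.2 y.2).
Proof.
apply: inj_card_bij; first exact: wreath_ext_inj.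
rewrite /wreath_elt !card_prod !card_ffun !card_Sn !card_ord.
by rewrite factS expnS; lia.
Qed.

End WreathExtension.

Section WreathSums.
Variables (R : comNzRingType) (s : nat -> R) (k : nat).

Definition wreath_sum n (w : 'I_n -> nat) : R :=
  \sum_(x : wreath_elt k n) cycle_prod s (wreath_perm x) (w \o fst).

Definition block_sum a : R := \sum_(q : {perm 'I_k}) cycle_prod s q (fun=> a).

(** The elements are sorted by the image of block [p]. If [p] is fixed, its cycles split off and
    depend on [q] alone. Otherwise [p] can be contracted into its successor and the result no longer
    depends on [q], which explains the factor $k!$. *)
Lemma wreath_sum_rec n (w : 'I_n.+1 -> nat) (p : 'I_n.+1) :
  wreath_sum w = block_sum (w p) * wreath_sum (w \o lift p)
   + (k`!)%:R * \sum_(j < n) wreath_sum (fun i => w (lift p i) + (i == j) * w p)%N.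
Proof.
rewrite {1}/wreath_sum (reindex _ (onW_bij _ (@wreath_ext_bij k n p))) /=.
rewrite -(pair_bigA _ (fun y x =>
  cycle_prod s (wreath_perm (wreath_ext p y.1 y.2 x)) (w \o fst))) /=.
rewrite -(pair_bigA _ (fun q j =>
  \sum_x cycle_prod s (wreath_perm (wreath_ext p q j x)) (w \o fst))) /=.
have loopE q x : cycle_prod s (wreath_perm (wreath_ext p q p x)) (w \o fst) =
    cycle_prod s q (fun=> w p) * cycle_prod s (wreath_perm x) ((w \o lift p) \o fst).
  rewrite (@cycle_prod_sum _ s _ _ _ (pair p) (fun y => (lift p y.1, y.2)) q (wreath_perm x)) //.
  - by move=> r r' [].
  - by move=> [i r] [i' r'] /= E; move: (congr1 fst E) (congr1 snd E) => /= /lift_inj -> ->.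
  - by move=> r [i r'] /=; apply/eqP => -[/eqP]; rewrite (negbTE (neq_lift _ _)).
  - move=> [i r]; case: (unliftP p i) => [i' ->|->]; last by left; exists r.
    by right; exists (i', r).
  - by move=> r; rewrite wreath_ext_pivot.
  - move=> [i r]; rewrite wreath_ext_lift eq_sym (negbTE (neq_lift _ _)).
    by rewrite permE.
(* The contraction sends each point of block [p] to its image, which lies on the same cycle. *)
have mergeE q j x : cycle_prod s (wreath_perm (wreath_ext p q (lift p j) x)) (w \o fst) =
    cycle_prod s (wreath_perm x) ((fun i => w (lift p i) + (i == j) * w p)%N \o fst).
  apply: (@cycle_prod_retract _ s _ _ _ _
    (fun y => if unlift p y.1 is Some i then (i, y.2) else (j, q y.2))
    (fun y => (lift p y.1, y.2))).
  - by move=> [i r]; rewrite /= liftK.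
  - move=> [i r] /=; case: unliftP => [i' ->|->] /=; first exact: porbit_id.
    by rewrite -(wreath_ext_pivot p q (lift p j) x r) -{1}[wreath_perm _]expg1 mem_porbit.
  - move=> [i r] /=; case: (unliftP p i) => [i' ->|->] /=.
      rewrite wreath_ext_lift (inj_eq (@lift_inj _ p)); case: eqP => [E|_] /=.
        rewrite unlift_none permKV -E.
        by rewrite (_ : (_, _) = (wreath_perm x ^+ 1)%g (i', r)) ?mem_porbit // expg1 permE.
      by rewrite liftK (_ : (_, _) = (wreath_perm x ^+ 1)%g (i', r)) ?mem_porbit // expg1 permE.
    by rewrite wreath_ext_pivot /= liftK porbit_id.
  - move=> [i r]; rewrite permE /wreath_fun /=.
    set v := wreath_perm _.
    (* A step of [x] into block [j] is two steps of the extension, by way of block [p]; every other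
       step is a single one. *)
    have [E|/eqP ne] := eqVneq (x.2 i) j.
      rewrite (_ : (_, _) = (v ^+ 2)%g (lift p i, r)) ?mem_porbit // expgS expg1 permM.
      by rewrite wreath_ext_lift E eqxx wreath_ext_pivot permKV.
    rewrite (_ : (_, _) = (v ^+ 1)%g (lift p i, r)) ?mem_porbit // expg1.
    by rewrite wreath_ext_lift (inj_eq (@lift_inj _ p)) (negbTE (introN eqP ne)).
  (* The fibre over [(i, r)] consists of the lifted point and, if [i = j], of the one point of block
     [p] that [q] sends to [r]. *)
  - move=> [i r] /=.
    rewrite big_mkcond -(pair_bigA _ (fun a b => if (if unlift p a is Some i'
      then (i', b) else (j, q b)) == (i, r) then w a else 0))%N /=.
    rewrite (bigD1_ord p) //= unlift_none [RHS]addnC; congr (_ + _)%N.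
      under eq_bigr => a _ do under eq_bigr => b _ do rewrite liftK xpair_eqE.
      rewrite (bigD1 i) //= [X in (_ + X)%N]big1 => [|a /negbTE ->]; last by rewrite big1.
      by rewrite addn0 eqxx /= -big_mkcond big_pred1_eq.
    rewrite (reindex_inj (@perm_inj _ q^-1%g)) /=.
    under eq_bigr => b _ do rewrite permKV xpair_eqE eq_sym.
    by case: (i == j); [rewrite mul1n -big_mkcond big_pred1_eq | rewrite big1].
rewrite exchange_big /= (bigD1_ord p) //=; congr (_ + _).
  rewrite /block_sum mulr_suml; apply: eq_bigr => q _.
  by rewrite mulr_sumr; apply: eq_bigr => x _; exact: loopE.
rewrite mulr_sumr; apply: eq_bigr => j _.
under eq_bigr => q _ do under eq_bigr => x _ do rewrite mergeE.
by rewrite sumr_const card_Sn mulr_natl.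
Qed.

End WreathSums.

(** * Averages over the wreath product and their recursion *)

Section WreathMeans.
Variables (R : numFieldType).
Implicit Types (s : nat -> R).

Definition wreath_mean s k n (w : 'I_n -> nat) : R :=
  wreath_sum s k w / (#|wreath_elt k n|)%:R.

Definition block_mean s k a : R := block_sum s k a / (k`!)%:R.

Lemma card_wreath_elt k n : #|wreath_elt k n| = (k`! ^ n * n`!)%N.
Proof. by rewrite /wreath_elt card_prod card_ffun !card_Sn card_ord. Qed.

Lemma wreath_mean_rec s k n (w : 'I_n.+1 -> nat) (p : 'I_n.+1) :
  n.+1%:R * wreath_mean s k w = block_mean s k (w p) * wreath_mean s k (w \o lift p)
   + \sum_(j < n) wreath_mean s k (fun i => w (lift p i) + (i == j) * w p)%N.
Proof.
rewrite /wreath_mean (wreath_sum_rec s k w p) -mulr_suml !card_wreath_elt.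
rewrite /block_mean expnS factS !natrM.
have nz m : (m`!)%:R != 0 :> R by rewrite pnatr_eq0 -lt0n fact_gt0.
have kz : ((k`! ^ n)%N)%:R != 0 :> R by rewrite pnatr_eq0 -lt0n expn_gt0 fact_gt0.
have n1 : n.+1%:R != 0 :> R by rewrite pnatr_eq0.
by field; rewrite kz !nz addrC natr1.
Qed.

(** Always remove the marked block: either only unit blocks remain, or its successor becomes the
    marked block with weight [a.+1]. Here [l] counts the unit blocks absorbed before the cycle
    closes. The right-hand side does not depend on the position [p], so the sum over successors
    cancels the factor on the left of the induction hypothesis. *)
Lemma wreath_mean_marked s k n (p : 'I_n.+1) a :
  n.+1%:R * wreath_mean s k (fun i => if i == p then a else 1)%N =
  \sum_(l < n.+1) block_mean s k (a + l)%N * wreath_mean s k (fun _ : 'I_(n - l) => 1)%N.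
Proof.
have liftE m (p' : 'I_m.+1) b : (fun i => if i == p' then b else 1)%N \o lift p' = (fun=> 1)%N.
  by apply/funext => i /=; rewrite eq_sym (negbTE (neq_lift _ _)).
elim: n p a => [|n IH] p a; rewrite (wreath_mean_rec s k _ p) eqxx liftE [RHS]big_ord_recl /= addn0.
  by rewrite !big_ord0.
congr (_ + _).
have E (j : 'I_n.+1) : wreath_mean s k (fun i => (if lift p i == p then a else 1) + (i == j) * a)%N
   = n.+1%:R^-1 * \sum_(l < n.+1) block_mean s k (a.+1 + l)%N *
       wreath_mean s k (fun _ : 'I_(n - l) => 1)%N.
  rewrite -(IH j) [RHS]mulrA mulVf ?pnatr_eq0 // mul1r; congr wreath_mean; apply/funext => i.
  by rewrite eq_sym (negbTE (neq_lift _ _)); case: eqP => _; rewrite ?mul1n.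
under eq_bigr => j _ do rewrite E.
rewrite sumr_const card_ord -[LHS]mulr_natl mulrA mulfV ?pnatr_eq0 // mul1r.
by apply: eq_bigr => l _; rewrite /= /bump /= add1n subSS addnS addSn.
Qed.

Definition unit_mean s k n : R := wreath_mean s k (fun _ : 'I_n => 1)%N.

Lemma unit_mean_rec s k n :
  n.+1%:R * unit_mean s k n.+1 = \sum_(l < n.+1) block_mean s k l.+1 * unit_mean s k (n - l)%N.
Proof.
have := wreath_mean_marked s k (@ord0 n) 1; under eq_fun do rewrite if_same.
by move=> ->; apply: eq_bigr => l _; rewrite add1n.
Qed.

Lemma unit_mean0 s k : unit_mean s k 0 = 1.
Proof.
rewrite /unit_mean /wreath_mean /wreath_sum.
have C0 : forall x : wreath_elt k 0,
    cycle_prod s (wreath_perm x) ((fun _ : 'I_0 => 1)%N \o fst) = 1.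
  move=> x; rewrite /cycle_prod big1 // => C /imsetP[[[i lti] r]]; by [].
under eq_bigr => x _ do rewrite C0.
by rewrite sumr_const card_wreath_elt expn0 divff // pnatr_eq0.
Qed.

(** $S_k$ is the wreath product of $S_1$ by $S_k$. Inner averages thereby become averages of the
    same kind as the outer ones, and one limit theorem, for [unit_mean f 1], serves for both. *)
Lemma block_sum_sym s k a :
  block_sum s k a = wreath_sum (fun l => s (a * l)%N) 1 (fun _ : 'I_k => 1)%N.
Proof.
have S1 (q : {perm 'I_1}) : q = 1%g by apply/permP => i; rewrite !ord1.
pose e (h : {perm 'I_k}) : wreath_elt 1 k := ([ffun=> 1%g], h).
rewrite /wreath_sum (reindex e) /=; last first.
  exists snd => // -[g h] _; congr (_, _); apply/ffunP => i.
  by rewrite ffunE [RHS]S1.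
rewrite /block_sum; apply: eq_bigr => h _.
transitivity (cycle_prod (fun l => s (a * l)%N) h (fun=> 1%N)).
  by rewrite -cycle_prod_scale muln1.
apply/esym/(@cycle_prod_retract _ _ _ _ _ _ fst (fun i => (i, ord0))) => //.
- by move=> [i r] /=; rewrite [r]ord1 porbit_id.
- by move=> [i r]; rewrite permE /= -{1}[h]expg1 mem_porbit.
- move=> i; rewrite (_ : (_, _) = (wreath_perm (e h) ^+ 1)%g (i, ord0)) ?mem_porbit //.
  by rewrite expg1 permE /wreath_fun /=; congr pair; rewrite [RHS]ord1.
- move=> i; rewrite (big_pred1 (i, ord0)) // => -[i' r] /=.
  by rewrite xpair_eqE [r]ord1 eqxx andbT.
Qed.

Lemma block_mean_sym s k a : block_mean s k a = unit_mean (fun l => s (a * l)%N) 1 k.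
Proof.
by rewrite /block_mean block_sum_sym /unit_mean /wreath_mean card_wreath_elt exp1n mul1n.
Qed.

Lemma block_mean1 s a : block_mean s 1 a = s a.
Proof.
have S1 (q : {perm 'I_1}) : q = 1%g by apply/permP => i; rewrite !ord1.
rewrite /block_mean divr1 /block_sum (big_pred1 1%g) => [|q]; last first.
  by rewrite /= [q]S1 eqxx.
rewrite /cycle_prod (big_pred1 [set ord0]) => [|C] /=; first by rewrite big_set1.
apply/imsetP/eqP => [[i _ ->]|->]; [|exists ord0 => //];
  by apply/setP => j; rewrite [j]ord1 ?[i]ord1 inE porbit_id.
Qed.

Lemma wreath_mean_itv s k n w : (forall l, 0 <= s l <= 1) ->
  0 <= wreath_mean s k (w : 'I_n -> nat) <= 1.
Proof.
move=> s01; have c01 (x : wreath_elt k n) : 0 <= cycle_prod s (wreath_perm x) (w \o fst) <= 1.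
  rewrite prodr_ge0 => [|C _]; last by case/andP: (s01 (\sum_(x in C) (w \o fst) x)%N).
  by apply: prodr_ile1 => C _; exact: s01.
have c0 : 0 < (#|wreath_elt k n|)%:R :> R.
  by rewrite ltr0n card_wreath_elt muln_gt0 expn_gt0 !fact_gt0.
rewrite /wreath_mean divr_ge0 ?ler0n ?sumr_ge0 //= => [|x _]; last by case/andP: (c01 x).
rewrite ler_pdivrMr // mul1r -sum1_card natr_sum.
by apply: ler_sum => x _; case/andP: (c01 x).
Qed.

Lemma unit_mean_itv s k n : (forall l, 0 <= s l <= 1) -> 0 <= unit_mean s k n <= 1.
Proof. exact: wreath_mean_itv. Qed.

Lemma block_mean_itv s k a : (forall l, 0 <= s l <= 1) -> 0 <= block_mean s k a <= 1.
Proof. by move=> s01; rewrite block_mean_sym; exact: unit_mean_itv. Qed.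

Lemma block_mean_eq1 s k a : (forall l, (0 < l)%N -> s (a * l)%N = 1) -> block_mean s k a = 1.
Proof.
move=> s1; rewrite /block_mean /block_sum.
have C1 : forall q : {perm 'I_k}, cycle_prod s q (fun=> a) = 1.
  move=> q; rewrite /cycle_prod big1 // => C /imsetP[i _ ->].
  rewrite sum_nat_const mulnC s1 //; apply/card_gt0P; exists i; exact: porbit_id.
under eq_bigr => q _ do rewrite C1.
by rewrite sumr_const card_Sn divff // pnatr_eq0 -lt0n fact_gt0.
Qed.

End WreathMeans.

(** * Convergence of cycle index averages *)

Section CycleIndexLimit.
Variables (R : realType).
Implicit Types (f E : nat -> R).

(** The recursion for the coefficients of $E(X)=\exp(\sum_{l\ge1} f_l X^l/l)$, read off from $X
    E'(X) = (\sum_l f_l X^l)\,E(X)$. *)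
Definition cycle_index_rec f E := E 0 = 1 /\
  forall n, n.+1%:R * E n.+1 = \sum_(l < n.+1) f l.+1 * E (n - l)%N.

Lemma cycle_index_rec_uniq f E E' :
  cycle_index_rec f E -> cycle_index_rec f E' -> E =1 E'.
Proof.
move=> [E0 EE] [E0' EE'] n; elim/ltn_ind: n => -[|n] IH; first by rewrite E0.
apply: (@mulfI _ n.+1%:R); first by rewrite pnatr_eq0.
rewrite EE EE'; apply: eq_bigr => l _; rewrite IH //; lia.
Qed.

Lemma unit_mean_cycle_index s k :
  cycle_index_rec (block_mean s k) (unit_mean (R := R) s k).
Proof. by split=> [|n]; [exact: unit_mean0|exact: unit_mean_rec]. Qed.

(** The recursion sees [k] only through [block_mean s k], so the average over the wreath product is
    an average over $S_n$ with the inner averages as cycle weights: the plethysm of cycle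
    indices. *)
Lemma unit_mean_block s k n :
  unit_mean (R := R) s k n = unit_mean (block_mean s k) 1 n.
Proof.
apply: cycle_index_rec_uniq (unit_mean_cycle_index s k) _ n.
have [E0 EE] := unit_mean_cycle_index (block_mean s k) 1; split=> // n.
by rewrite EE; apply: eq_bigr => l _; rewrite block_mean1.
Qed.

Lemma unit_mean1_cycle_index f : cycle_index_rec f (unit_mean f 1).
Proof.
have [E0 EE] := unit_mean_cycle_index f 1; split=> // n.
by rewrite EE; apply: eq_bigr => l _; rewrite block_mean1.
Qed.

(* Values at negative integers are set to 0, which removes all boundary
   conditions from convolutions. *)
Definition zext E (z : int) : R := if z is Posz n then E n else 0.

Lemma zext_neg E (z : int) : z < 0 -> zext E z = 0.
Proof. by case: z. Qed.

Lemma zext_rec f E (z : int) J : cycle_index_rec f E -> z <= J%:Z ->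
  z%:~R * zext E z = \sum_(l < J) f l.+1 * zext E (z - l.+1%:Z).
Proof.
move=> [E0 EE]; case: z => [[|n]|n] zJ.
- rewrite mul0r big1 // => l _; rewrite zext_neg ?mulr0 //; lia.
- rewrite /= EE (big_ord_widen_cond J xpredT (fun l => f l.+1 * E (n - l)%N)); last lia.
  rewrite [LHS]big_mkcond; apply: eq_bigr => l _ /=.
  case: ifP => ln; last by rewrite zext_neg ?mulr0 //; lia.
  by rewrite (_ : Posz n.+1 - Posz l.+1 = Posz (n - l)%N) //; lia.
- rewrite mulr0 big1 // => l _; rewrite zext_neg ?mulr0 //; lia.
Qed.

(** The coefficient of $X^z$ in $e^{aX^L}\sum_n E_nX^n$, cut after [J] terms. For [L > 0] and
    [z < J] the cut loses nothing. *)
Definition exp_conv L (a : R) E J (z : int) : R :=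
  \sum_(j < J) exp_coeff a j * zext E (z - (L * j)%:Z).

Lemma exp_conv_stable L a E J (z : int) : (0 < L)%N -> z < J%:Z ->
  exp_conv L a E J.+1 z = exp_conv L a E J z.
Proof.
move=> L0 zJ; rewrite /exp_conv big_ord_recr /= zext_neg ?mulr0 ?addr0 //.
have : (J <= L * J)%N by rewrite leq_pmull.
lia.
Qed.

Lemma exp_conv_stable2 L a E J K (z : int) : (0 < L)%N -> z < J%:Z -> (J <= K)%N ->
  exp_conv L a E K z = exp_conv L a E J z.
Proof.
move=> L0 zJ /subnK <-; elim: (K - J)%N => [//|i IH].
by rewrite addSn exp_conv_stable ?IH //; lia.
Qed.

Lemma exp_conv_neg L a E J (z : int) : z < 0 -> exp_conv L a E J z = 0.
Proof. by move=> z0; rewrite /exp_conv big1 // => j _; rewrite zext_neg ?mulr0 //; lia. Qed.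

Lemma exp_coeffS (a : R) j : j.+1%:R * exp_coeff a j.+1 = a * exp_coeff a j.
Proof.
rewrite /exp_coeff /= exprS factS natrM.
have : (j`!)%:R != 0 :> R by rewrite pnatr_eq0 -lt0n fact_gt0.
have : j.+1%:R != 0 :> R by rewrite pnatr_eq0.
by move=> h1 h2; field; rewrite h2 addrC natr1.
Qed.

(* Generating functions: passing from [f'] to [f] multiplies
   [exp (\sum_l f' l X^l / l)] by [exp (a X^L)]. *)
Lemma exp_conv_rec L f f' E : (0 < L)%N -> f' L = 1 -> (forall l, l != L -> f' l = f l) ->
  cycle_index_rec f' E ->
  cycle_index_rec f (fun n => exp_conv L ((f L - 1) / L%:R) E n.+1 n).
Proof.
move=> L0 f'L f'f EE; set a := (f L - 1) / L%:R; split.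
  by rewrite /exp_conv big_ord1 muln0 subr0 /= EE.1 mulr1 /exp_coeff /= expr0 fact0 divr1.
(* One truncation for all coefficients up to [n.+1], so that sums can be exchanged; the summand [L]
   keeps the index [L.-1] in range even when [L] exceeds [n.+2]. *)
move=> n; set J := (n.+2 + L)%N.
have GE (z : int) : z < J%:Z -> forall K, z < K%:Z -> exp_conv L a E K z = exp_conv L a E J z.
  move=> zJ K zK; have [KJ|JK] := leqP K J; first by rewrite (exp_conv_stable2 _ _ _ zK KJ).
  by rewrite (exp_conv_stable2 _ _ _ zJ (ltnW JK)).
rewrite (GE n.+1) //; try lia.
transitivity (\sum_(l < J) f l.+1 * exp_conv L a E J (n.+1%:Z - l.+1%:Z)); last first.
  rewrite (big_ord_widen_cond J xpredT
    (fun l => f l.+1 * exp_conv L a E (n - l).+1 (n - l)%N)); last lia.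
  rewrite [RHS]big_mkcond; apply: eq_bigr => l _ /=.
  case: ifP => ln; last by rewrite exp_conv_neg ?mulr0 //; lia.
  rewrite (_ : Posz n.+1 - Posz l.+1 = Posz (n - l)%N); last lia.
  by congr (_ * _); rewrite (GE (n - l)%N) //; lia.
(* The product rule for $X\,d/dX$: write $n+1=(n+1-Lj)+Lj$. The first part is the recursion for [E];
   in the second, $j\,a^j/j!=a\cdot a^{j-1}/(j-1)!$ and $La=f_L-1$. *)
have -> : n.+1%:R * exp_conv L a E J n.+1 =
    \sum_(l < J) f' l.+1 * exp_conv L a E J (n.+1%:Z - l.+1%:Z)
    + (f L - 1) * exp_conv L a E J (n.+1%:Z - L%:Z).
  rewrite /exp_conv mulr_sumr.
  transitivity (
    \sum_(j < J) exp_coeff a j * ((n.+1%:Z - (L * j)%:Z)%:~R * zext E (n.+1%:Z - (L * j)%:Z))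
    + \sum_(j < J) L%:R * (j%:R * exp_coeff a j) * zext E (n.+1%:Z - (L * j)%:Z)).
    rewrite -big_split /=; apply: eq_bigr => j _.
    by rewrite intrB -!pmulrn natrM; ring.
  congr (_ + _).
    under eq_bigr => j _ do (rewrite (zext_rec (J := J) EE); [rewrite mulr_sumr | rewrite /J; lia]).
    rewrite exchange_big; apply: eq_bigr => l _; rewrite mulr_sumr; apply: eq_bigr => j _.
    by rewrite mulrCA; congr (_ * (_ * zext _ _)); lia.
  have -> : J = (n.+1 + L).+1 by rewrite /J; lia.
  rewrite big_ord_recl /= mul0r mulr0 mul0r add0r -/(exp_conv L a E (n.+1 + L).+1 (n.+1%:Z - L%:Z)).
  rewrite exp_conv_stable //; last lia.
  rewrite /exp_conv mulr_sumr; apply: eq_bigr => j _.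
  rewrite /bump /= add1n exp_coeffS !mulrA [L%:R * _]mulrC mulfK ?pnatr_eq0 -?lt0n //.
  by congr (_ * zext _ _); lia.
have LJ : (L.-1 < J)%N by rewrite /J; lia.
rewrite (bigD1 (Ordinal LJ)) //= [RHS](bigD1 (Ordinal LJ)) //= prednK // f'L.
rewrite addrAC; congr (_ + _); first by ring.
apply: eq_bigr => l lL; rewrite f'f //; apply: contraNneq lL => E1.
by apply/eqP/val_inj => /=; rewrite -E1.
Qed.

Local Open Scope classical_set_scope.

Lemma cvg_series_exp_coeff (x : R) : series (exp_coeff x) n @[n --> \oo] --> expR x.
Proof. exact: is_cvg_series_exp_coeff. Qed.

Lemma series_exp_coeff1_le n : series (exp_coeff 1) n <= expR 1 :> R.
Proof.
apply: nondecreasing_cvgn_le; last exact: is_cvg_series_exp_coeff.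
by apply: nondecreasing_series => i _ _; rewrite exp_coeff_ge0.
Qed.

(** The tail at [1] dominates the tail at every [a] with [|a| <= 1]; the uniformity in [f] rests on
    this. *)
Definition exp_tail J : R := expR 1 - series (exp_coeff 1) J.

Lemma exp_coeff_le (a : R) j : `|a| <= 1 -> `|exp_coeff a j| <= exp_coeff 1 j.
Proof.
move=> a1; rewrite /exp_coeff /= expr1n normrM normrX normfV [`|(j`!)%:R|]ger0_norm ?ler0n //.
by rewrite ler_wpM2r ?invr_ge0 ?ler0n // exprn_ile1.
Qed.

Lemma exp_partial_tail (w : nat -> R) J K : (forall j, `|w j| <= exp_coeff 1 j) ->
  `|\sum_(J <= j < K) w j| <= exp_tail J.
Proof.
move=> wle; apply: le_trans (ler_norm_sum _ _ _) _.
apply: (@le_trans _ _ (\sum_(J <= j < K) exp_coeff 1 j)); first exact: ler_sum.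
have [KJ|JK] := leqP K J.
  by rewrite big_geq // subr_ge0 series_exp_coeff1_le.
rewrite lerBrDl /series /= -big_cat_nat //=; last exact: ltnW.
exact: series_exp_coeff1_le.
Qed.

Lemma expR_partial_tail (a : R) J : `|a| <= 1 ->
  `|expR a - series (exp_coeff a) J| <= exp_tail J.
Proof.
move=> a1.
have c : `|series (exp_coeff a) n - series (exp_coeff a) J| @[n --> \oo] -->
         `|expR a - series (exp_coeff a) J|.
  by apply: cvg_norm; apply: cvgB; [exact: cvg_series_exp_coeff|exact: cvg_cst].
apply: (ler_cvg_to c (cvg_cst (exp_tail J))).
exists J => // n /= Jn; rewrite sub_series Jn.
by apply: exp_partial_tail => j; exact: exp_coeff_le.
Qed.

Lemma exp_tail_cvg0 : exp_tail J @[J --> \oo] --> 0.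
Proof.
rewrite -(subrr (expR 1)); apply: cvgB; first exact: cvg_cst.
exact: cvg_series_exp_coeff.
Qed.

(** In the induction step [f'] resets the value at [m.+1] to [1], and [unit_mean f 1] is the
    convolution of [unit_mean f' 1] with the exponential series of [a]. Since [|a| <= 1], the cut
    [J] is independent of [f], and in the first [J] terms the late values of [unit_mean f' 1] are
    close to their limit. *)
Lemma unit_mean1_cvg m (e : R) : 0 < e -> exists n0, forall f,
  (forall l, 0 <= f l <= 1) -> (forall l, (m < l)%N -> f l = 1) ->
  forall n, (n0 <= n)%N ->
  `|unit_mean f 1 n - expR (\sum_(l < m) (f l.+1 - 1) / l.+1%:R)| < e.
Proof.
elim: m e => [|m IH] e e0.
  exists 0 => f f01 f1 n _; rewrite big_ord0 expR0.
  suff -> : unit_mean f 1 n = 1 by rewrite subrr normr0.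
  apply: (@cycle_index_rec_uniq f) n; first exact: unit_mean1_cycle_index.
  split=> // n; under eq_bigr => l _ do rewrite f1 // mulr1.
  by rewrite sumr_const card_ord mulr1.
have e4 : 0 < e / 4 by rewrite divr_gt0.
have E1 : 0 < expR 1 :> R by exact: expR_gt0.
(* The factors $|a^j/j!|$ sum to at most [expR 1], so an error of [e / 4 / expR 1] per term adds up
   to at most [e / 4]. Two exponential tails cost another [e / 4] each. *)
have [n1 IH1] := IH _ (divr_gt0 e4 E1).
have [J _ tJ] := cvgr0_norm_lt _ exp_tail_cvg0 _ e4.
have {tJ} tJ : exp_tail J < e / 4.
  by apply: le_lt_trans (tJ J (leqnn J)); exact: ler_norm.
(* For [j < J] the shifted index [n - m.+1 * j] is still at least [n1], and the sum over [j <= n] is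
   long enough to be cut at [J]. *)
exists (n1 + m.+1 * J + J)%N => f f01 f1 n nn.
pose f' l := if l == m.+1 then 1 else f l.
set a := (f m.+1 - 1) / m.+1%:R.
set E := unit_mean f' 1.
have f'01 l : 0 <= f' l <= 1 by rewrite /f'; case: eqP => _; rewrite ?ler01 ?lexx ?f01.
have f'1 l : (m < l)%N -> f' l = 1.
  by rewrite /f'; case: eqP => // ne ml; apply: f1; lia.
have E01 j : 0 <= E j <= 1 by exact: unit_mean_itv.
have a1 : `|a| <= 1.
  rewrite /a normrM normfV [`|m.+1%:R|]ger0_norm ?ler0n // ler_pdivrMr ?ltr0n // mul1r.
  case/andP: (f01 m.+1) => h0 h1; rewrite ler_norml.
  by have : 1 <= m.+1%:R :> R; [rewrite ler1n|lra].
have z01 z : 0 <= zext E z <= 1 by case: z => j //=; rewrite lexx ler01.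
rewrite big_ord_recr /= -/a addrC expRD.
set V := expR (\sum_(l < m) _).
have [V0 V1] : 0 <= V /\ V <= 1.
  rewrite expR_ge0; split=> //; rewrite /V -[leRHS]expR0 ler_expR; apply: sumr_le0 => l _.
  by rewrite mulr_le0_ge0 ?invr_ge0 ?ler0n // subr_le0; case/andP: (f01 l.+1).
have -> : unit_mean f 1 n = exp_conv m.+1 a E n.+1 n.
  apply: (@cycle_index_rec_uniq f _ (fun n : nat => exp_conv m.+1 a E n.+1 n)).
    exact: unit_mean1_cycle_index.
  apply: (@exp_conv_rec _ f f') => //; first by rewrite /f' eqxx.
    by move=> l /negbTE; rewrite /f' => ->.
  exact: unit_mean1_cycle_index.
have Vf' : V = expR (\sum_(l < m) (f' l.+1 - 1) / l.+1%:R).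
  by congr expR; apply: eq_bigr => l _; rewrite /f' eqn_leq [(m < l.+1)%N]ltnNge ltn_ord andbF.
have Jn : (J <= n.+1)%N by lia.
rewrite /exp_conv -(big_mkord xpredT (fun j => exp_coeff a j * zext E (n%:Z - (m.+1 * j)%:Z))).
rewrite (@big_cat_nat _ _ _ J) //=.
set S1 := \sum_(0 <= j < J) _; set S2 := \sum_(J <= j < _) _.
have S2le : `|S2| <= exp_tail J.
  apply: exp_partial_tail => j; rewrite normrM.
  apply: le_trans (exp_coeff_le j a1); rewrite ler_piMr //.
  by case/andP: (z01 (n%:Z - (m.+1 * j)%:Z)) => h0 h1; rewrite ger0_norm.
have aV : `|(series (exp_coeff a) J - expR a) * V| <= exp_tail J.
  rewrite normrM distrC; apply: le_trans (expR_partial_tail J a1).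
  by rewrite ler_piMr // ger0_norm.
have S1le : `|S1 - series (exp_coeff a) J * V| <= e / 4.
  rewrite /S1 /series /= mulr_suml -sumrB.
  apply: (@le_trans _ _ (\sum_(0 <= j < J) exp_coeff 1 j * (e / 4 / expR 1))).
    rewrite !big_mkord; apply: le_trans (ler_norm_sum _ _ _) _; apply: ler_sum => j _.
    rewrite -mulrBr normrM ler_pM ?exp_coeff_le //.
    have mj : (m.+1 * j <= m.+1 * J)%N by rewrite leq_mul2l (ltnW (ltn_ord j)) orbT.
    rewrite (_ : n%:Z - (m.+1 * j)%:Z = (n - m.+1 * j)%N); last lia.
    by rewrite /= /E Vf'; apply/ltW/IH1 => //; lia.
  rewrite -mulr_suml mulrC -[leRHS](divfK (lt0r_neq0 E1)) ler_wpM2l //; last first.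
    exact: series_exp_coeff1_le.
  exact: ltW (divr_gt0 e4 E1).
rewrite (_ : _ - _ = (S1 - series (exp_coeff a) J * V) + S2
   + (series (exp_coeff a) J - expR a) * V); last by ring.
apply: le_lt_trans (ler_normD _ _) _; apply: le_lt_trans (lerD (ler_normD _ _) aV) _.
by apply: le_lt_trans (lerD (lerD S1le S2le) (lexx _)) _; lra.
Qed.

End CycleIndexLimit.

(** * From powers to indicators *)

Section PowersToIndicators.
Variables (R : realType).
Local Open Scope classical_set_scope.

Definition unit_valued (f : nat -> R) := forall c, 0 <= f c <= 1.

(** The combination is the one in [shifted_powerE]. Additivity is asked only where all three
    functions are unit-valued, because [mean] and [poisson_mean] need convergent integrals and
    series. *)
Definition affine_functional (L : (nat -> R) -> R) := forall f g t, 0 < t < 1 ->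
  unit_valued f -> unit_valued g -> unit_valued (fun c => f c + t * g c) ->
  L (fun c => f c + t * g c) = L f + t * L g.

Definition nat_indic (v c : nat) : R := (c == v)%:R.

Lemma unit_valued_indic v : unit_valued (nat_indic v).
Proof. by move=> c; rewrite /nat_indic; case: eqP; rewrite ?lexx ?ler01. Qed.

Definition shifted_power (t : R) v c : R := if (v <= c)%N then t ^+ (c - v) else 0.

Lemma unit_valued_shifted t v : 0 < t < 1 -> unit_valued (shifted_power t v).
Proof.
move=> /andP[t0 t1] c; rewrite /shifted_power.
by case: ifP => _; rewrite ?lexx ?ler01 // exprn_ge0 ?exprn_ile1 // ltW.
Qed.

Lemma shifted_powerE t v :
  shifted_power t v = (fun c => nat_indic v c + t * shifted_power t v.+1 c).
Proof.
apply/funext => c; rewrite /shifted_power /nat_indic; case: ltngtP => [vc|vc|->].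
- by rewrite add0r -exprS -subSn.
- by rewrite mulr0 addr0.
- by rewrite subnn expr0 mulr0 addr0.
Qed.

Section OneVariable.
Variables (K : Type) (F : set_system K) (FF : ProperFilter F).
Variables (L : K -> (nat -> R) -> R) (C : R).
Hypothesis affL : forall x, affine_functional (L x).
Hypothesis bndL : forall x f, unit_valued f -> `|L x f| <= C.

(* [t^(c-v) 1{c >= v} = 1{c = v} + t t^(c-v-1) 1{c >= v+1}], where the last term
   is uniformly small as [t -> 0]. *)
Lemma cvg_indicators :
  (forall t, 0 < t < 1 -> L x (fun c => t ^+ c) @[x --> F] --> 0) ->
  forall v, L x (nat_indic v) @[x --> F] --> 0.
Proof.
move=> powL v.
have LE x t u : 0 < t < 1 -> L x (shifted_power t u) =
    L x (nat_indic u) + t * L x (shifted_power t u.+1).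
  move=> t01; rewrite {1}shifted_powerE affL //; first exact: unit_valued_indic.
  - exact: unit_valued_shifted.
  - by rewrite -shifted_powerE; exact: unit_valued_shifted.
have C0 : 0 <= C.
  have [x _] := filter_ex (@filterT _ F _).
  exact: le_trans (normr_ge0 _) (bndL x (unit_valued_indic 0)).
(* Both limits are carried along: shifted powers at [v] give the indicator of [v], and subtracting
   it and dividing by [t] gives the shifted powers at [v.+1]. *)
suff : (forall t, 0 < t < 1 -> L x (shifted_power t v) @[x --> F] --> 0) /\
  L x (nat_indic v) @[x --> F] --> 0 by case.
have indP u : (forall t, 0 < t < 1 -> L x (shifted_power t u) @[x --> F] --> 0) ->
    L x (nat_indic u) @[x --> F] --> 0.
  move=> shL; apply/cvgr0Pnorm_lt => e e0.
  (* Chosen so that [t < 1] and [t * C <= e / 2]; the [1] in [C + 1] guards against [C = 0]. *)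
  pose t := Num.min (2^-1) (e / 2 / (C + 1)).
  have C1 : 0 < C + 1 by lra.
  have e2 : 0 < e / 2 by lra.
  have t01 : 0 < t < 1.
    by rewrite lt_min gt_min !divr_gt0 ?invr_gt0 ?ltr0n //=; apply/orP; left; lra.
  have tC : t * C <= e / 2.
    apply: (@le_trans _ _ (e / 2 / (C + 1) * (C + 1))); last by rewrite divfK ?lt0r_neq0.
    rewrite ler_pM ?ge_min ?lexx ?orbT //; last lra.
    by case/andP: t01 => /ltW.
  near=> x.
  have -> : L x (nat_indic u) = L x (shifted_power t u) - t * L x (shifted_power t u.+1).
    by rewrite (LE x t u t01); ring.
  apply: le_lt_trans (ler_normB _ _) _.
  have h1 : `|L x (shifted_power t u)| < e / 2.
    by near: x; exact: (cvgr0_norm_lt _ (shL t t01) _ e2).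
  have h2 : `|t * L x (shifted_power t u.+1)| <= t * C.
    case/andP: (t01) => t0 t1; rewrite normrM gtr0_norm // ler_pM2l //.
    by apply: bndL; exact: unit_valued_shifted.
  by apply: lt_le_trans (ltr_leD h1 (le_trans h2 tC)) _; lra.
elim: v => [|v [IHs IHi]].
  have s0 : forall t, 0 < t < 1 -> L x (shifted_power t 0) @[x --> F] --> 0.
    move=> t t01; rewrite (_ : shifted_power t 0 = fun c => t ^+ c); first exact: powL.
    by apply/funext => c; rewrite /shifted_power subn0.
  by split=> //; exact: indP.
have sS : forall t, 0 < t < 1 -> L x (shifted_power t v.+1) @[x --> F] --> 0.
  move=> t t01; have t0 : t != 0 by case/andP: t01 => /lt0r_neq0.
  rewrite (_ : (fun x => _) = (fun x => t^-1 * (L x (shifted_power t v) - L x (nat_indic v)))).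
    by rewrite -(mulr0 t^-1) -(subr0 0); apply: cvgMr; apply: cvgB => //; exact: IHs.
  by apply/funext => x; rewrite (LE x t v t01); field.
by split=> //; exact: indP.
Unshelve. all: by end_near. Qed.

End OneVariable.

Section ManyVariables.
Variables (I : eqType) (s : seq I).
Implicit Types (phi : I -> nat -> R) (i : I).

Definition upd phi i f : I -> nat -> R := fun j => if j == i then f else phi j.

Definition multiaffine (D : (I -> nat -> R) -> R) := forall phi i, i \in s ->
  (forall j, unit_valued (phi j)) -> affine_functional (fun f => D (upd phi i f)).

Definition subunital (D : (I -> nat -> R) -> R) := forall phi,
  (forall j, unit_valued (phi j)) -> `|D phi| <= 1.

Variables (K : Type) (F : set_system K) (FF : ProperFilter F).
Variables (D1 D2 : K -> (I -> nat -> R) -> R).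
Hypothesis affD1 : forall x, multiaffine (D1 x).
Hypothesis affD2 : forall x, multiaffine (D2 x).
Hypothesis bndD1 : forall x, subunital (D1 x).
Hypothesis bndD2 : forall x, subunital (D2 x).
Hypothesis powD : forall t : I -> R, (forall i, 0 < t i < 1) ->
  D1 x (fun i c => t i ^+ c) - D2 x (fun i c => t i ^+ c) @[x --> F] --> 0.

Definition mixed_family (r : seq I) (v : I -> nat) (t : I -> R) i : nat -> R :=
  if i \in r then nat_indic (v i) else fun c => t i ^+ c.

(** Powers are replaced by indicators one coordinate at a time. With the other coordinates fixed,
    the difference of the two functionals is affine in the current one and bounded by [2]. The
    induction hypothesis ranges over all [t], since it is used for every power in the coordinate
    being replaced. *)
Lemma multi_cvg_indicators (v : I -> nat) (t : I -> R) : (forall i, 0 < t i < 1) ->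
  D1 x (mixed_family s v t) - D2 x (mixed_family s v t) @[x --> F] --> 0.
Proof.
suff : forall r, {subset r <= s} -> forall t, (forall i, 0 < t i < 1) ->
  D1 x (mixed_family r v t) - D2 x (mixed_family r v t) @[x --> F] --> 0 by apply.
elim=> [|i r IH] rs {}t t01; first exact: powD.
have rs' : {subset r <= s} by move=> j jr; apply: rs; rewrite inE jr orbT.
have [ir|inr] := boolP (i \in r).
  have -> : mixed_family (i :: r) v t = mixed_family r v t.
    by apply/funext => j; rewrite /mixed_family inE; case: eqP => [->|//]; rewrite ir.
  exact: IH.
have is_ : i \in s by apply: rs; rewrite mem_head.
have mu j : unit_valued (mixed_family r v t j).
  rewrite /mixed_family; case: ifP => _; first exact: unit_valued_indic.
  by move=> c; case/andP: (t01 j) => /ltW t0 /ltW t1; rewrite exprn_ge0 ?exprn_ile1.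
have updu f : unit_valued f -> forall j, unit_valued (upd (mixed_family r v t) i f j).
  by move=> fu j; rewrite /upd; case: eqP.
have -> : mixed_family (i :: r) v t = upd (mixed_family r v t) i (nat_indic (v i)).
  apply/funext => j; rewrite /mixed_family /upd inE; case: eqP => [->|//].
  by [].
apply: (@cvg_indicators _ F FF (fun x f => D1 x (upd (mixed_family r v t) i f)
   - D2 x (upd (mixed_family r v t) i f)) (1 + 1)).
- by move=> x f g u u01 fu gu fgu; rewrite affD1 // affD2 //; ring.
- move=> x f fu; apply: le_trans (ler_normB _ _) _.
  by apply: lerD; [apply: bndD1|apply: bndD2]; exact: updu.
- move=> u u01; pose t' j := if j == i then u else t j.
  have -> : upd (mixed_family r v t) i (fun c => u ^+ c) = mixed_family r v t'.
    apply/funext => j; rewrite /upd /mixed_family /t'; case: eqP => [->|//].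
    by rewrite (negbTE inr).
  by apply: IH => // j; rewrite /t'; case: eqP.
Qed.

End ManyVariables.

Lemma prod_upd (I : eqType) (s : seq I) (phi : I -> nat -> R) i f (G : I -> (nat -> R) -> R) :
  uniq s -> i \in s -> \prod_(j <- s) G j (upd phi i f j) =
  G i f * \prod_(j <- s | j != i) G j (phi j).
Proof.
move=> us is_; rewrite (bigD1_seq i) //= /upd eqxx; congr (_ * _).
by apply: eq_bigr => j /negbTE ->.
Qed.

Definition half_family (I : eqType) (s : seq I) v := mixed_family s v (fun=> 2^-1).

(** The limit statement for constant sequences of functionals. *)
Lemma eq_indicators (I : eqType) (s : seq I) (D1 D2 : (I -> nat -> R) -> R) v :
  multiaffine s D1 -> multiaffine s D2 -> subunital D1 -> subunital D2 ->
  (forall t : I -> R, (forall i, 0 < t i < 1) ->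
    D1 (fun i c => t i ^+ c) = D2 (fun i c => t i ^+ c)) ->
  D1 (half_family s v) = D2 (half_family s v).
Proof.
move=> a1 a2 b1 b2 e12; apply/eqP; rewrite -subr_eq0; apply/eqP.
have t01 (i : I) : 0 < (2^-1 : R) < 1 by apply/andP; split; lra.
have := @multi_cvg_indicators I s nat \oo _ (fun=> D1) (fun=> D2) (fun=> a1) (fun=> a2)
  (fun=> b1) (fun=> b2) _ v (fun=> 2^-1) t01.
move=> H; apply: (@cvg_unique _ _ (cst (D1 (half_family s v) - D2 (half_family s v)) @ \oo)) => //.
  exact: cvg_cst.
by apply: H => t t01'; rewrite e12 // subrr; exact: cvg_cst.
Qed.

Lemma prod_half_family (I : eqType) (s : seq I) v (G : I -> (nat -> R) -> R) :
  \prod_(i <- s) G i (half_family s v i) = \prod_(i <- s) G i (nat_indic (v i)).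
Proof. by apply: eq_big_seq => i is_; rewrite /half_family /mixed_family is_. Qed.

End PowersToIndicators.

Arguments nat_indic {R} v c.
Arguments unit_valued_indic {R} v.

(** * Generating functions of the limit objects *)

Section Means.
Context {d : measure_display} {T : measurableType d} {R : realType}.
Variable P : probability T R.
Local Open Scope classical_set_scope.
Implicit Types (X Y : T -> R) (V : T -> nat) (g : nat -> R).

Definition unital_rv X := measurable_fun setT X /\ forall t, 0 <= X t <= 1.

Definition mean X : R := Rintegral P setT X.

Lemma unital_integrable X : unital_rv X -> P.-integrable setT (EFin \o X).
Proof.
move=> [mX X01]; apply: measurable_bounded_integrable => //.
  exact: le_lt_trans (probability_le1 _ measurableT) (ltry 1).
exists 1; split; first exact: num_real.
by move=> M M1 t _ /=; case/andP: (X01 t) => h0 h1; rewrite ger0_norm //; lra.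
Qed.

Lemma mean_affine X Y c : unital_rv X -> unital_rv Y ->
  mean (fun t => X t + c * Y t) = mean X + c * mean Y.
Proof.
move=> /unital_integrable iX /unital_integrable iY; rewrite /mean RintegralD //.
  by rewrite RintegralZl.
rewrite (_ : _ \o _ = (fun t => c%:E * (EFin \o Y) t)%E); last by apply/funext.
exact: integrableZl.
Qed.

Lemma mean_cst r : mean (fun=> r) = r.
Proof. by rewrite /mean Rintegral_cst //= probability_setT mulr1. Qed.

Lemma unital_cst r : 0 <= r <= 1 -> unital_rv (fun=> r).
Proof. by move=> r01; split=> //; exact: measurable_cst. Qed.

Lemma mean_itv X : unital_rv X -> 0 <= mean X <= 1.
Proof.
move=> uX; have [_ X01] := uX; rewrite Rintegral_ge0 /= => [|t _]; last by case/andP: (X01 t).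
rewrite -[leRHS](mean_cst 1); apply: le_Rintegral => //.
- exact: unital_integrable.
- by apply: unital_integrable; apply: unital_cst; rewrite ler01 lexx.
- by move=> t _; case/andP: (X01 t).
Qed.

Lemma mean_cvg (X_ : nat -> T -> R) X : (forall n, unital_rv (X_ n)) ->
  (forall t, X_ n t @[n --> \oo] --> X t) -> mean (X_ n) @[n --> \oo] --> mean X.
Proof.
move=> uX cX.
have EcX t : (EFin \o X_ n) t @[n --> \oo] --> (EFin \o X) t.
  by apply: cvg_EFin; [exact: nearW|exact: cX].
have mX : measurable_fun setT X.
  apply/measurable_EFinP; apply: (emeasurable_fun_cvg (fun n => EFin \o X_ n)) => [n|t _].
    by apply/measurable_EFinP; case: (uX n).
  exact: EcX.
have [] // := @dominated_convergence _ T R P setT measurableT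
  (fun n => EFin \o X_ n) (EFin \o X) (cst 1%E).
- by move=> n; apply/measurable_EFinP; case: (uX n).
- exact/measurable_EFinP.
- by apply: aeW => t _; exact: EcX.
- exact: finite_measure_integrable_cst.
- apply: aeW => t n _ /=; case/andP: ((uX n).2 t) => h0 h1.
  by rewrite lee_fin ger0_norm.
move=> iX _ cI; apply: fine_cvg; rewrite fineK //.
exact: integrable_fin_num iX.
Qed.

Lemma unital_prod (I : eqType) (s : seq I) (X : I -> T -> R) :
  (forall i, i \in s -> unital_rv (X i)) -> unital_rv (fun t => \prod_(i <- s) X i t).
Proof.
move=> uX; split; first by apply: measurable_prod => i /uX[].
move=> t; rewrite big_seq prodr_ge0 => [|i /uX[_ /(_ t)/andP[]]//].
by apply: prodr_ile1 => i /uX[_].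
Qed.

Lemma unital_mul X Y : unital_rv X -> unital_rv Y -> unital_rv (fun t => X t * Y t).
Proof.
move=> [mX X01] [mY Y01]; split; first exact: measurable_funM.
move=> t; case/andP: (X01 t) => x0 x1; case/andP: (Y01 t) => y0 y1.
by rewrite mulr_ge0 //= mulr_ile1.
Qed.

Lemma nat_rv_preimage V (B : set nat) : nat_rv V -> measurable [set t | B (V t)].
Proof.
move=> mV; rewrite (_ : mkset _ = \bigcup_(v in B) [set t | V t = v]).
  by apply: bigcup_measurable => v _.
by apply/seteqP; split=> [t Bt|t [v Bv /= ->]//]; exists (V t).
Qed.

Lemma unital_nat_rv V g : nat_rv V -> unit_valued g -> unital_rv (fun t => g (V t)).
Proof.
move=> mV g01; split=> [_ B mB|t]; last exact: g01.
by rewrite setTI; exact: (nat_rv_preimage (g @^-1` B)).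
Qed.

Lemma mean_event (A : set T) : measurable A -> mean (\1_A) = fine (P A).
Proof. by move=> mA; rewrite /mean /Rintegral integral_indic // setIT. Qed.

Lemma mean_indic V v : nat_rv V ->
  mean (fun t => nat_indic v (V t)) = fine (P [set t | V t = v]).
Proof.
move=> mV; rewrite -mean_event //; congr mean; apply/funext => t.
rewrite /nat_indic indicE; congr (nat_of_bool _)%:R.
by apply/eqP/idP => [Vv|/set_mem //]; exact: mem_set.
Qed.

Lemma mean_sum (Y : nat -> T -> R) (c : nat -> R) M : (forall u, unital_rv (Y u)) ->
  mean (fun t => \sum_(u < M) c u * Y u t) = \sum_(u < M) c u * mean (Y u).
Proof.
move=> uY; have iY u : P.-integrable setT (EFin \o (fun t => c u * Y u t)).
  rewrite (_ : _ \o _ = (fun t => (c u)%:E * (EFin \o Y u) t)%E); last by apply/funext.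
  by apply: integrableZl => //; exact: unital_integrable.
elim: M => [|M IH]; first by under eq_fun do rewrite big_ord0; rewrite mean_cst big_ord0.
under eq_fun do rewrite big_ord_recr /=.
have iS : P.-integrable setT (EFin \o (fun t => \sum_(u < M) c u * Y u t)).
  rewrite (_ : _ \o _ = (fun t => \sum_(u < M) (c u * Y u t)%:E)%E); last first.
    by apply/funext => t /=; rewrite -sumEFin.
  by apply: integrable_sum => // u _; exact: iY.
rewrite big_ord_recr /= -IH /mean RintegralD //.
by congr (_ + _); rewrite RintegralZl //; exact: unital_integrable.
Qed.

(** A substitute for conditioning on [V]: cutting [g] off at [M] leaves a finite sum over the values
    of [V], and dominated convergence removes the cut. *)
Lemma mean_by_values V g Y : nat_rv V -> unit_valued g -> unital_rv Y ->
  \sum_(u < M) g u * mean (fun t => nat_indic u (V t) * Y t) @[M --> \oo]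
  --> mean (fun t => g (V t) * Y t).
Proof.
move=> mV g01 uY.
have uI u : unital_rv (fun t => nat_indic u (V t) * Y t).
  by apply: unital_mul => //; apply: unital_nat_rv => //; exact: unit_valued_indic.
pose gM M c := if (c < M)%N then g c else 0.
have E M : (fun t => \sum_(u < M) g u * (nat_indic u (V t) * Y t)) =
    (fun t => gM M (V t) * Y t).
  apply/funext => t; rewrite /gM /nat_indic; case: ltnP => VM.
    rewrite (bigD1 (Ordinal VM)) //= eqxx mul1r big1 ?addr0 // => u uV.
    rewrite (_ : (V t == u) = false) ?mul0r ?mulr0 //; apply: contraNF uV => /eqP Vu.
    by apply/eqP/val_inj.
  rewrite mul0r big1 // => u _; rewrite (_ : (V t == u) = false) ?mul0r ?mulr0 //.
  by apply/negbTE; rewrite neq_ltn (leq_trans (ltn_ord u) VM) orbT.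
rewrite (_ : (fun M => _) = (fun M => mean (fun t => gM M (V t) * Y t))); last first.
  by apply/funext => M; rewrite -E (mean_sum g M uI).
apply: (@mean_cvg (fun M t => gM M (V t) * Y t)) => [M|t].
  apply: unital_mul => //; apply: unital_nat_rv => // c; rewrite /gM.
  by case: ifP => _; rewrite ?lexx ?ler01 // g01.
apply: cvgMl; apply: cvg_near_cst; exists (V t).+1 => // M /= VM.
by rewrite /gM VM.
Qed.

Lemma unital_diag V (Y : nat -> T -> R) : nat_rv V -> (forall u, unital_rv (Y u)) ->
  unital_rv (fun t => Y (V t) t).
Proof.
move=> mV uY; split=> [_ B mB|t]; last exact: (uY (V t)).2.
rewrite setTI (_ : _ @^-1` B = \bigcup_u ([set t | V t = u] `&` Y u @^-1` B)).
  apply: bigcup_measurable => u _; apply: measurableI => //.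
  by rewrite -[X in measurable X]setTI; exact: (uY u).1.
by apply/seteqP; split=> [t Bt|t [u _ [/= <-]]//]; exists (V t).
Qed.

Lemma prod_indic (I : Type) (s : seq I) (W : I -> T -> nat) (v : I -> nat) t :
  \prod_(i <- s) nat_indic (v i) (W i t) =
  \1_(\big[setI/setT]_(i <- s) [set t | W i t = v i]) t :> R.
Proof.
elim: s => [|i s IH]; first by rewrite !big_nil indicT.
rewrite !big_cons IH indicI /=; congr (_ * _).
rewrite /nat_indic indicE; congr (nat_of_bool _)%:R.
by apply/eqP/idP => [Vv|/set_mem //]; exact: mem_set.
Qed.

Lemma mean_prod_indep (I : eqType) (D : pred I) (V : I -> T -> nat) (g : I -> nat -> R) s :
  mutually_independent P D V -> (forall i, unit_valued (g i)) -> uniq s -> all D s ->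
  mean (fun t => \prod_(i <- s) g i (V i t)) = \prod_(i <- s) mean (fun t => g i (V i t)).
Proof.
move=> [mV indV] g01.
have uV i f : D i -> unit_valued f -> unital_rv (fun t => f (V i t)).
  by move=> Di; exact: unital_nat_rv (mV i Di).
(* Independence is given for point events only. The variables in [r] already carry indicators; each
   function [g i] in [s] is expanded by values, which moves [i] into [r]. *)
suff H r v : uniq (r ++ s) -> all D (r ++ s) ->
    mean (fun t => (\prod_(i <- r) nat_indic (v i) (V i t)) * \prod_(i <- s) g i (V i t))
    = \prod_(i <- r) mean (fun t => nat_indic (v i) (V i t)) *
      \prod_(i <- s) mean (fun t => g i (V i t)).
  move=> us Ds; have := H [::] (fun=> 0%N) us Ds; rewrite big_nil mul1r => <-.
  by congr mean; apply/funext => t; rewrite big_nil mul1r.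
elim: s r v => [|i s IH] r v us Ds.
  rewrite !cats0 in us Ds; rewrite big_nil mulr1.
  under eq_fun do rewrite big_nil mulr1 prod_indic.
  have mA i : i \in r -> measurable [set t | V i t = v i].
    by move=> /(allP Ds) Di; exact: mV.
  rewrite mean_event; last first.
    by rewrite big_seq; elim/big_rec: _ => // i B /mA mi mB; exact: measurableI.
  rewrite indV //; elim: r us Ds mA => [|i r IHr] us Ds mA; first by rewrite !big_nil.
  case/andP: us => _ us; case/andP: Ds => Di Ds.
  rewrite !big_cons fineM ?fin_num_measure //; last 2 first.
  - by apply: mA; rewrite mem_head.
  - rewrite -indV //; apply: fin_num_measure.
    rewrite big_seq; elim/big_rec: _ => // j B jr mB; apply: measurableI => //.
    by apply: mA; rewrite inE jr orbT.
  rewrite IHr //; last by move=> j jr; apply: mA; rewrite inE jr orbT.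
  by rewrite mean_indic //; exact: mV.
have us' : uniq ((i :: r) ++ s) by rewrite -cat1s -catA uniq_catCA cat1s.
have Ds' : all D ((i :: r) ++ s) by move: Ds; rewrite /= !all_cat /= andbCA.
have Di : D i by case/andP: Ds'.
have iNr : i \notin r by move: us'; rewrite /= mem_cat negb_or => /andP[/andP[]].
set Y := fun t => (\prod_(j <- r) nat_indic (v j) (V j t)) * \prod_(j <- s) g j (V j t).
have uY : unital_rv Y.
  move: Ds'; rewrite /= all_cat => /and3P[_ /allP Dr /allP Ds'].
  by apply: unital_mul; apply: unital_prod => j jr; apply: uV => //;
    [exact: Dr|exact: unit_valued_indic|exact: Ds'].
have c1 := mean_by_values (mV i Di) (g01 i) uY.
have c2 := mean_by_values (mV i Di) (g01 i) (@unital_cst 1 _).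
have {}c2 := c2 ltac:(by rewrite ler01 lexx).
set C := \prod_(j <- r) mean (fun t => nat_indic (v j) (V j t)) *
      \prod_(j <- s) mean (fun t => g j (V j t)).
have E u : mean (fun t => nat_indic u (V i t) * Y t) =
    mean (fun t => nat_indic u (V i t) * 1) * C.
  have Er (F : I -> nat -> R) : \prod_(j <- r) F j (if j == i then u else v j) =
      \prod_(j <- r) F j (v j).
    by apply: eq_big_seq => j jr; case: eqP jr iNr => // -> ->.
  have -> : (fun t => nat_indic u (V i t) * 1) = (fun t => nat_indic u (V i t) : R).
    by apply/funext => t; rewrite mulr1.
  have := IH (i :: r) (fun j => if j == i then u else v j) us' Ds'.
  rewrite big_cons eqxx (Er (fun j w => mean (fun t => nat_indic w (V j t)))).
  rewrite -mulrA -/C => <-.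
  congr mean; apply/funext => t.
  by rewrite big_cons eqxx (Er (fun j w => nat_indic w (V j t))) mulrA.
rewrite big_cons mulrCA -/C -[_ * C]/(mean (fun t => g i (V i t)) * C).
have -> : (fun t => (\prod_(j <- r) nat_indic (v j) (V j t)) * \prod_(j <- (i :: s)) g j (V j t)) =
    (fun t => g i (V i t) * Y t).
  by apply/funext => t; rewrite big_cons mulrCA.
apply: (cvg_unique _ c1) => //.
have -> : (fun t => g i (V i t)) = (fun t => g i (V i t) * 1).
  by apply/funext => t; rewrite mulr1.
rewrite (_ : (fun M => \sum_(u < M) _) =
  (fun M => (\sum_(u < M) g i u * mean (fun t => nat_indic u (V i t) * 1)) * C)).
  by apply: cvgMl.
by apply/funext => M; rewrite mulr_suml; apply: eq_bigr => u _; rewrite E mulrA.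
Qed.

Lemma cvg_poisson_pgf (lam x : R) : 0 < lam ->
  \sum_(u < M) x ^+ u * poisson_pmf lam u @[M --> \oo] --> expR (lam * (x - 1)).
Proof.
move=> l0; rewrite mulrBr mulr1 expRD mulrC.
rewrite (_ : (fun M => _) = (fun M => expR (- lam) * series (exp_coeff (lam * x)) M)).
  by apply: cvgMr; exact: cvg_series_exp_coeff.
apply/funext => M; rewrite /series /= big_mkord mulr_sumr; apply: eq_bigr => u _.
by rewrite /poisson_pmf l0 /exp_coeff /= exprMn; ring.
Qed.

(** The Poisson expectation as a bare series, so that product formulas for the limit refer to no
    probability space. *)
Definition poisson_mean (lam : R) g : R :=
  limn (fun M => \sum_(u < M) g u * poisson_pmf lam u).

Lemma mean_poisson V lam g : poisson_law P V lam -> unit_valued g ->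
  mean (fun t => g (V t)) = poisson_mean lam g.
Proof.
move=> [mV lV] g01; have := mean_by_values mV g01 (@unital_cst 1 _).
move=> /(_ ltac:(by rewrite ler01 lexx)) c.
rewrite (_ : (fun t => g (V t)) = (fun t => g (V t) * 1)); last first.
  by apply/funext => t; rewrite mulr1.
apply/esym/cvg_lim => //; apply: cvg_trans c.
rewrite [X in _ `=>` X @ _](_ : _ = fun M => \sum_(u < M) g u * poisson_pmf lam u) //.
apply/funext => M; apply: eq_bigr => u _; congr (_ * _).
by under eq_fun do rewrite mulr1; rewrite mean_indic // lV.
Qed.

Lemma poisson_mean_pow (lam x : R) : 0 < lam ->
  poisson_mean lam (fun c => x ^+ c) = expR (lam * (x - 1)).
Proof. by move=> l0; apply: cvg_lim => //; exact: cvg_poisson_pgf. Qed.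

Section Compound.
Variables (N : nat -> T -> nat) (Z : nat -> nat -> nat -> T -> nat).
Hypothesis HN : forall l : nat, (0 < l)%N -> poisson_law P (N l) (l%:R)^-1.
Hypothesis HZ : forall l r q : nat, (0 < l)%N -> (0 < r)%N -> (0 < q)%N ->
  poisson_law P (Z l r q) (q%:R)^-1.
Hypothesis Hind : mutually_independent P limit_index_ok (limit_family N Z).
Variables (m : nat) (psi : nat -> nat -> nat -> R).
Hypothesis psi01 : forall l q, unit_valued (psi l q).

(** The part of a test product that sees the [r]-th copy of the sequence $Z$ attached to [l]. Two
    choices of [psi] are used: [s (l * q) ^+ c] for the $A_i$ and [X_factor] for the $X_{l,q,j}$. *)
Definition cluster l r t : R := \prod_(1 <= q < m.+1) psi l q (Z l r q t).

Definition compound l t : R := \prod_(1 <= r < (N l t).+1) cluster l r t.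

Definition cluster_mean l : R := \prod_(1 <= q < m.+1) poisson_mean (q%:R)^-1 (psi l q).

Definition compound_mean l : R := expR ((cluster_mean l - 1) / l%:R).

Definition index_block (i : limit_index) : nat :=
  match i with inl l => l | inr (l, _, _) => l end.

Lemma unital_cluster l r : (0 < l)%N -> (0 < r)%N -> unital_rv (cluster l r).
Proof.
move=> l0 r0; apply: unital_prod => q; rewrite mem_index_iota => /andP[q0 _].
exact: (unital_nat_rv (HZ l0 r0 q0).1).
Qed.

Lemma unital_compound l : (0 < l)%N -> unital_rv (compound l).
Proof.
move=> l0; apply: (@unital_diag (N l) (fun u t => \prod_(1 <= r < u.+1) cluster l r t)).
  exact: (HN l0).1.
move=> u; apply: unital_prod => r; rewrite mem_index_iota => /andP[r0 _].
exact: unital_cluster.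
Qed.

Definition block_indices l u : seq limit_index :=
  inl l :: [seq inr (l, r, q) | r <- index_iota 1 u.+1, q <- index_iota 1 m.+1].

(** A compound has a random number of factors, so independence does not apply to it directly. On
    [N l = u] it is a product over the finite list [block_indices l u], which joins [s] in the
    induction hypothesis; summing over [u] gives the Poisson generating function at
    [cluster_mean l]. *)
Lemma mean_compound_prod (L : seq nat) (s : seq limit_index) (f : limit_index -> nat -> R) :
  uniq L -> all (leq 1) L -> uniq s -> all limit_index_ok s ->
  (forall i, i \in s -> index_block i \notin L) -> (forall i, unit_valued (f i)) ->
  mean (fun t => (\prod_(i <- s) f i (limit_family N Z i t)) * \prod_(l <- L) compound l t)
  = \prod_(i <- s) mean (fun t => f i (limit_family N Z i t)) * \prod_(l <- L) compound_mean l.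
Proof.
elim: L s f => [|l L IH] s f uL L0 us s0 sL f01.
  rewrite big_nil mulr1; under eq_fun do rewrite big_nil mulr1.
  exact: mean_prod_indep Hind f01 us s0.
case/andP: uL => lL uL; case/andP: L0 => l0 L0.
set A := fun t => \prod_(i <- s) f i (limit_family N Z i t).
set B := fun t => \prod_(l <- L) compound l t.
set Y := fun t => A t * (compound l t * B t).
have uY : unital_rv Y.
  apply: unital_mul.
    apply: unital_prod => i is_; apply: unital_nat_rv => //.
    by case: Hind => + _; apply; exact: (allP s0).
  apply: unital_mul; first exact: unital_compound.
  by apply: unital_prod => l' l'L; apply: unital_compound; exact: (allP L0).
have [mN lN] := HN l0.
have u1 : unit_valued (fun=> 1 : R) by move=> c; rewrite ler01 lexx.
have c1 := mean_by_values mN u1 uY.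
set C := \prod_(i <- s) mean (fun t => f i (limit_family N Z i t)) *
  \prod_(l' <- L) compound_mean l'.
have E u : mean (fun t => nat_indic u (N l t) * Y t) =
    cluster_mean l ^+ u * poisson_pmf (l%:R)^-1 u * C.
  (* On block [l] the test functions are dictated by the compound and the event [N l = u]; the
     indices in [s] belong to other blocks and keep theirs. *)
  pose f' (i : limit_index) := if index_block i == l then
      match i with inl _ => nat_indic u | inr (_, _, q) => psi l q end else f i.
  have f'01 i : unit_valued (f' i).
    rewrite /f'; case: eqP => // _; case: i => [?|[[? ?] q]] //.
    exact: unit_valued_indic.
  have fs i : i \in s -> f' i = f i.
    move/sL; rewrite inE negb_or /f' => /andP[/negbTE -> //].
  have block_prod (G : limit_index -> (nat -> R) -> R) :
      \prod_(i <- block_indices l u ++ s) G i (f' i) =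
      (G (inl l) (nat_indic u) *
       \prod_(1 <= r < u.+1) \prod_(1 <= q < m.+1) G (inr (l, r, q)) (psi l q)) *
      \prod_(i <- s) G i (f i).
    rewrite big_cat; congr (_ * _); last by apply: eq_big_seq => i /fs ->.
    by rewrite big_cons big_allpairs_dep /f' /= eqxx.
  transitivity (mean (fun t => (\prod_(i <- block_indices l u ++ s)
      f' i (limit_family N Z i t)) * B t)).
    congr mean; apply/funext => t.
    rewrite (block_prod (fun i g => g (limit_family N Z i t))) /=.
    rewrite /Y /A /nat_indic /compound; case: eqP => [->|_]; last by rewrite !mul0r.
    by rewrite !mul1r mulrCA mulrA.
  rewrite IH //; first last.
  - move=> i; rewrite mem_cat => /orP[|/sL]; last by rewrite inE negb_or => /andP[].
    by rewrite inE => /predU1P[->//|/allpairsP[[r q] [_ _ ->]]].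
  - rewrite all_cat s0 andbT /= l0; apply/allP => i /allpairsP[[r q]] /= [].
    by rewrite !mem_index_iota => /andP[r0 _] /andP[q0 _] ->; rewrite /= l0 r0 q0.
  - rewrite cat_uniq us andbT; apply/andP; split.
      rewrite /= allpairs_uniq ?iota_uniq // ?andbT; first by apply/allpairsP => -[[r q] []].
      by move=> [r q] [r' q'] _ _ /= [-> ->].
    apply/hasPn => i /sL; rewrite inE negb_or => /andP[il _]; apply: contra il.
    by rewrite inE => /predU1P[->//|/allpairsP[[r q] [_ _ ->]]] /=.
  rewrite (block_prod (fun i g => mean (fun t => g (limit_family N Z i t)))) /=.
  rewrite mean_indic // lN /= -mulrA -/C; congr (_ * _); rewrite mulrC; congr (_ * _).
  rewrite (eq_big_nat _ _ (F2 := fun=> cluster_mean l)); last first.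
    move=> r /andP[r0 _]; apply: eq_big_nat => q /andP[q0 _].
    by rewrite (mean_poisson (HZ l0 r0 q0)).
  by rewrite prodr_const_nat subn1.
rewrite big_cons [RHS]mulrCA -/C.
rewrite (_ : (fun t => _) = (fun t => 1 * Y t)); last first.
  by apply/funext => t; rewrite mul1r big_cons.
apply: (cvg_unique _ c1) => //.
rewrite (_ : (fun M => \sum_(u < M) _) =
  (fun M => (\sum_(u < M) cluster_mean l ^+ u * poisson_pmf (l%:R)^-1 u) * C)).
  apply: cvgMl; rewrite /compound_mean mulrC; apply: cvg_poisson_pgf.
  by rewrite invr_gt0 ltr0n.
by apply/funext => M; rewrite mulr_suml; apply: eq_bigr => u _; rewrite mul1r E.
Qed.

Lemma mean_compound (L : seq nat) : uniq L -> all (leq 1) L ->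
  mean (fun t => \prod_(l <- L) compound l t) = \prod_(l <- L) compound_mean l.
Proof.
move=> uL L0; have f01 (i : limit_index) : unit_valued (fun=> 0 : R).
  by move=> c; rewrite lexx ler01.
have := @mean_compound_prod L [::] (fun _ _ => 0) uL L0 isT isT
  (fun i => fun H => False_ind _ (notF H)) f01.
rewrite [X in _ = X * _]big_nil mul1r => <-.
by congr mean; apply/funext => t; rewrite big_nil mul1r.
Qed.

End Compound.
End Means.

(** * Joint limit of the wreath averages *)

Section WreathLimit.
Variables (R : realType).
Local Open Scope classical_set_scope.

Lemma unit_mean1_cvg_seq m (f : nat -> R) :
  (forall l, 0 <= f l <= 1) -> (forall l, (m < l)%N -> f l = 1) ->
  unit_mean f 1 n @[n --> \oo] --> expR (\sum_(l < m) (f l.+1 - 1) / l.+1%:R).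
Proof.
move=> f01 f1; apply/cvgrPdist_lt => e e0.
have [n0 H] := unit_mean1_cvg m e0; exists n0 => // n /= nn.
by rewrite distrC; exact: H.
Qed.

(** The inner exponential is the limit of [block_mean s k l.+1] as [k] grows. When [s = 1] beyond
    [m], the terms with $lq>m$ vanish, so both sums may stop at [m]. *)
Definition iterated_exp m (s : nat -> R) : R :=
  expR (\sum_(l < m) (expR (\sum_(q < m) (s (l.+1 * q.+1)%N - 1) / q.+1%:R) - 1) / l.+1%:R).

(** For large [n] the average is within [e / 2] of a continuous function of the finitely many inner
    averages, whatever [k] is; for large [k] that function is within [e / 2] of its limit. *)
Lemma unit_mean_wreath_cvg m (s : nat -> R) :
  (forall l, 0 <= s l <= 1) -> (forall l, (m < l)%N -> s l = 1) ->
  unit_mean s x.1 x.2 @[x --> filter_prod \oo \oo] --> iterated_exp m s.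
Proof.
move=> s01 s1; pose f k := block_mean s k.
have f01 k l : 0 <= f k l <= 1 by exact: block_mean_itv.
have f1 k l : (m < l)%N -> f k l = 1.
  move=> ml; apply: block_mean_eq1 => q q0; apply: s1; apply: leq_trans ml _.
  by rewrite leq_pmulr.
have fc l : f k l.+1 @[k --> \oo] --> expR (\sum_(q < m) (s (l.+1 * q.+1)%N - 1) / q.+1%:R).
  rewrite /f; under eq_fun do rewrite block_mean_sym.
  apply: (@unit_mean1_cvg_seq m (fun q => s (l.+1 * q)%N)) => // q mq.
  by apply: s1; apply: leq_trans mq _; rewrite leq_pmull.
have Fc : expR (\sum_(l < m) (f k l.+1 - 1) / l.+1%:R) @[k --> \oo] --> iterated_exp m s.
  apply: continuous_cvg; first exact: continuous_expR.
  apply: cvg_big => [|l _]; first exact: add_continuous.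
  by apply: cvgMl; apply: cvgB; [exact: fc|exact: cvg_cst].
apply/cvgrPdist_lt => e e0; have e2 : 0 < e / 2 by rewrite divr_gt0.
have [n0 H] := unit_mean1_cvg m e2.
move/cvgrPdist_lt: Fc => /(_ _ e2) [k0 _ K].
exists ([set k | (k0 <= k)%N], [set n | (n0 <= n)%N]) => /=.
  by split; [exists k0|exists n0].
move=> [k n] [/= kk nn]; rewrite unit_mean_block.
have h1 := K _ kk; have h2 := H _ (f01 k) (f1 k) _ nn.
rewrite distrC in h2; rewrite /= in h1.
apply: le_lt_trans (ler_distD (expR (\sum_(l < m) (f k l.+1 - 1) / l.+1%:R)) _ _) _.
by rewrite [ltRHS](splitr e); apply: ltrD.
Qed.

Lemma cycle_count_pow (X : finType) (u : {perm X}) m (t : nat -> R) :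
  \prod_(i <- iota 0 m) t i ^+ cycle_count u i.+1 =
  cycle_prod (fun l => if (0 < l <= m)%N then t l.-1 else 1) u (fun=> 1%N).
Proof.
have -> : iota 0 m = index_iota 0 m by rewrite /index_iota subn0.
rewrite /cycle_prod.
transitivity (\prod_(C in porbits u) \prod_(0 <= i < m) (if #|C| == i.+1 then t i else 1)).
  rewrite exchange_big /=; apply: eq_bigr => i _.
  rewrite -big_mkcondr /= prodr_const /cycle_count; congr (_ ^+ _).
  by apply: eq_card => C; rewrite !inE.
apply: eq_bigr => C _; rewrite sum1_card; case: ifP => Cm.
  have Cm' : (#|C|.-1 < m)%N by move: Cm; case: #|C|.
  rewrite big_mkord (bigD1 (Ordinal Cm')) //= prednK; last by case/andP: Cm.
  rewrite eqxx big1 ?mulr1 // => i ine; case: eqP => // Ci; case/eqP: ine.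
  by apply: val_inj => /=; rewrite Ci.
rewrite big_mkord big1 // => i _; case: eqP => // Ci.
by move: Cm; rewrite Ci /= ltn_ord.
Qed.

End WreathLimit.

Section DivisorSums.

Lemma divisors_filter i m : (0 < i <= m)%N ->
  perm_eq (divisors i) [seq l <- index_iota 1 m.+1 | l %| i]%N.
Proof.
move=> /andP[i0 im]; apply: uniq_perm; first exact: divisors_uniq.
  by rewrite filter_uniq // iota_uniq.
move=> l; rewrite -dvdn_divisors // mem_filter mem_index_iota.
case: (boolP (l %| i)%N) => //= li.
by rewrite (dvdn_gt0 i0 li) ltnS (leq_trans (dvdn_leq i0 li)).
Qed.

(** Reindexing by $i=lq$. The square of pairs on the right also contains pairs with $lq>m$, whose
    factors are [1]. *)
Lemma prod_divisors (R : comNzRingType) m (H : nat -> nat -> R) :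
  (forall l q, (m < l * q)%N -> H l q = 1) ->
  \prod_(1 <= i < m.+1) \prod_(l <- divisors i) H l (i %/ l)%N =
  \prod_(1 <= l < m.+1) \prod_(1 <= q < m.+1) H l q.
Proof.
move=> H1; transitivity (\prod_(1 <= i < m.+1) \prod_(1 <= l < m.+1)
    (if (l %| i)%N then H l (i %/ l)%N else 1)).
  apply: eq_big_nat => i im; rewrite (perm_big _ (divisors_filter im)) /=.
  by rewrite big_filter big_mkcond.
rewrite exchange_big /=; apply: eq_big_nat => l /andP[l0 lm].
transitivity (\prod_(1 <= i < m.+1) \prod_(1 <= q < m.+1) if i == (l * q)%N then H l q else 1).
  apply: eq_big_nat => i /andP[i0 im]; case: ifP => li; last first.
    rewrite big1_seq // => q _; case: eqP => // E; by rewrite E dvdn_mulr in li.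
  have iq : (i %/ l)%N \in index_iota 1 m.+1.
    by rewrite mem_index_iota divn_gt0 // dvdn_leq //= ltnS (leq_trans (leq_div _ _)).
  rewrite (bigD1_seq _ iq (iota_uniq _ _)) /= mulnC divnK // eqxx.
  rewrite big1 ?mulr1 // => q qi; case: eqP => // E; case/eqP: qi.
  by rewrite E mulKn.
rewrite exchange_big /=; apply: eq_big_nat => q /andP[q0 qm].
have [mlq|lqm] := ltnP m (l * q).
  by rewrite big1 ?H1 // => i _; case: eqP.
have lq : (l * q)%N \in index_iota 1 m.+1 by rewrite mem_index_iota muln_gt0 l0 q0 ltnS.
rewrite (bigD1_seq _ lq (iota_uniq _ _)) /= eqxx big1 ?mulr1 // => i /negbTE -> //.
Qed.

End DivisorSums.

Section MeanFunctionals.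
Context {d : measure_display} {T : measurableType d} {R : realType}.
Variable P : probability T R.

Lemma multiaffine_mean_prod (I : eqType) (s : seq I) (W : I -> T -> nat) :
  uniq s -> (forall i, i \in s -> nat_rv (W i)) ->
  multiaffine s (fun phi : I -> nat -> R => mean P (fun t => \prod_(i <- s) phi i (W i t))).
Proof.
move=> us mW phi i is_ phi01 f g c c01 f01 g01 fg01.
pose B t := \prod_(j <- s | j != i) phi j (W j t).
have uB : unital_rv B.
  rewrite /B; under eq_fun do rewrite -big_filter.
  apply: unital_prod => j; rewrite mem_filter => /andP[_ js].
  by apply: unital_nat_rv => //; exact: mW.
have E h : (fun t => \prod_(j <- s) upd phi i h j (W j t)) = (fun t => h (W i t) * B t).
  by apply/funext => t; exact: (prod_upd phi h (fun j g => g (W j t)) us is_).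
rewrite !E -mean_affine; first by congr mean; apply/funext => t; ring.
all: by apply: unital_mul => //; apply: unital_nat_rv => //; exact: mW.
Qed.

Lemma unital_mean_prod (I : eqType) (s : seq I) (W : I -> T -> nat) (phi : I -> nat -> R) :
  (forall i, i \in s -> nat_rv (W i)) -> (forall i, unit_valued (phi i)) ->
  0 <= mean P (fun t => \prod_(i <- s) phi i (W i t)) <= 1.
Proof.
move=> mW phi01; apply: mean_itv; apply: unital_prod => i is_.
by apply: unital_nat_rv => //; exact: mW.
Qed.

Lemma subunital_mean_prod (I : eqType) (s : seq I) (W : I -> T -> nat) :
  (forall i, i \in s -> nat_rv (W i)) ->
  subunital (fun phi : I -> nat -> R => mean P (fun t => \prod_(i <- s) phi i (W i t))).
Proof.
move=> mW phi phi01; have /andP[h0 h1] := unital_mean_prod mW phi01.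
by rewrite ger0_norm.
Qed.

Lemma mean_prod_indic (I : eqType) (s : seq I) (W : I -> T -> nat) (v : I -> nat) :
  (forall i, i \in s -> nat_rv (W i)) ->
  mean P (fun t => \prod_(i <- s) nat_indic (v i) (W i t)) =
  fine (P (\big[setI/setT]_(i <- s) [set t | W i t = v i]%classic)).
Proof.
move=> mW; rewrite -mean_event; last first.
  rewrite big_seq; elim/big_rec: _ => // i B is_ mB; apply: measurableI => //.
  exact: mW.
by congr mean; apply/funext => t; exact: prod_indic.
Qed.

End MeanFunctionals.

Section PoissonMean.
Variables (R : realType).
Local Open Scope classical_set_scope.

(** The identity on the naturals realises the Poisson law, which carries affinity, bounds and values
    on indicators over from [mean] to [poisson_mean]. *)
Lemma poisson_law_id (lam : R) : 0 < lam -> poisson_law (poisson_prob lam 0) id lam.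
Proof.
move=> l0; split=> [v|v]; first by [].
rewrite /= /poisson_prob l0 (_ : mkset _ = [set v]) ?esum_set1 //.
by rewrite lee_fin poisson_pmf_ge0.
Qed.

Lemma poisson_mean_affine (lam : R) : 0 < lam -> affine_functional (poisson_mean lam).
Proof.
move=> l0 f g c c01 f01 g01 fg01.
have pl := poisson_law_id l0.
rewrite -!(mean_poisson pl) //.
by apply: mean_affine; exact: (unital_nat_rv pl.1).
Qed.

Lemma poisson_mean_itv (lam : R) f : 0 < lam -> unit_valued f -> 0 <= poisson_mean lam f <= 1.
Proof.
move=> l0 f01; have pl := poisson_law_id l0; rewrite -(mean_poisson pl) //.
by apply: mean_itv; exact: (unital_nat_rv pl.1).
Qed.

Lemma poisson_mean_indic (lam : R) v : 0 < lam ->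
  poisson_mean lam (nat_indic v) = poisson_pmf lam v.
Proof.
move=> l0; have pl := poisson_law_id l0; rewrite -(mean_poisson pl) //;
  last exact: unit_valued_indic.
by rewrite (mean_indic _ _ pl.1) pl.2.
Qed.

Lemma poisson_mean1 (lam : R) : 0 < lam -> poisson_mean lam (fun=> 1) = 1.
Proof.
move=> l0; rewrite -(mean_poisson (poisson_law_id l0)); first by rewrite mean_cst.
by move=> c; rewrite ler01 lexx.
Qed.

(** At most one factor has exponent [1], so the product equals $1+\sum_j 1_{c=j}(t_j-1)$. *)
Lemma poisson_mean_cases (lam : R) (s : seq nat) (t : nat -> R) : 0 < lam -> uniq s ->
  (forall j, 0 <= t j <= 1) ->
  poisson_mean lam (fun c => \prod_(j <- s) t j ^+ (c == j)) =
  1 + \sum_(j <- s) poisson_pmf lam j * (t j - 1).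
Proof.
move=> l0 + t01; have pl := poisson_law_id l0.
have uR g : unit_valued g -> unital_rv (fun c : nat => g c : R).
  by move=> g01; exact: (unital_nat_rv pl.1 g01).
have u01 s' : unit_valued (fun c => \prod_(j <- s') t j ^+ (c == j)).
  move=> c; rewrite prodr_ge0 => [|j _]; last by rewrite exprn_ge0; case/andP: (t01 j).
  by apply: prodr_ile1 => j _; case: (c == j); rewrite ?expr0 ?expr1 ?ler01 ?lexx.
elim: s => [|j s IH] us.
  rewrite big_nil addr0 (_ : (fun c => _) = (fun=> 1)) ?poisson_mean1 //.
  by apply/funext => c; rewrite big_nil.
case/andP: us => js us; rewrite big_cons addrCA -(IH us).
rewrite -!(mean_poisson pl) // -(poisson_mean_indic j l0) -(mean_poisson pl);
  last exact: unit_valued_indic.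
rewrite addrC mulrC -mean_affine; [|exact: uR|exact/uR/unit_valued_indic].
congr mean; apply/funext => c; rewrite big_cons /nat_indic; case: eqP => [->|_] /=.
  rewrite big1_seq; first by rewrite mulr1 expr1; ring.
  by move=> i /andP[_ is_]; case: eqP is_ js => // <- ->.
by rewrite expr0 mul1r mulr0 addr0.
Qed.

End PoissonMean.

Section NatRandomVariables.
Context {d : measure_display} {T : measurableType d}.
Local Open Scope classical_set_scope.

Lemma nat_rv_comp (V : T -> nat) (f : nat -> nat) : nat_rv V -> nat_rv (fun t => f (V t)).
Proof. by move=> mV v; exact: (nat_rv_preimage [set u | f u = v] mV). Qed.

Lemma nat_rv_diag (V : T -> nat) (W : nat -> T -> nat) :
  nat_rv V -> (forall u, nat_rv (W u)) -> nat_rv (fun t => W (V t) t).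
Proof.
move=> mV mW v; rewrite (_ : mkset _ = \bigcup_u ([set t | V t = u] `&` [set t | W u t = v])).
  by apply: bigcup_measurable => u _; apply: measurableI; [exact: mV|exact: mW].
by apply/seteqP; split=> [t Wt|t [u _ [/= <-]]//]; exists (V t).
Qed.

Lemma nat_rv_sum (I : eqType) (s : seq I) (W : I -> T -> nat) :
  (forall i, i \in s -> nat_rv (W i)) -> nat_rv (fun t => \sum_(i <- s) W i t)%N.
Proof.
elim: s => [|i s IH] mW.
  move=> v; under eq_fun do rewrite big_nil.
  have [->|v0] := eqVneq v 0%N; first by rewrite (_ : mkset _ = setT) //; apply/seteqP.
  by rewrite (_ : mkset _ = set0) //; apply/seteqP; split=> // t /= /esym/eqP; rewrite (negbTE v0).
under eq_fun do rewrite big_cons.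
apply: (nat_rv_diag (W := fun u t => (u + \sum_(j <- s) W j t)%N)).
  by apply: mW; rewrite mem_head.
move=> u; apply: nat_rv_comp; apply: IH => j js; apply: mW.
by rewrite inE js orbT.
Qed.

End NatRandomVariables.

(** * Generating functions of the $A_i$ and the $X_{l,q,j}$ *)

Section LimitLaw.
Context {d : measure_display} {T : measurableType d} {R : realType}.
Variable P : probability T R.
Variables (N : nat -> T -> nat) (Z : nat -> nat -> nat -> T -> nat).
Hypothesis HN : forall l : nat, (0 < l)%N -> poisson_law P (N l) (l%:R)^-1.
Hypothesis HZ : forall l r q : nat, (0 < l)%N -> (0 < r)%N -> (0 < q)%N ->
  poisson_law P (Z l r q) (q%:R)^-1.
Hypothesis Hind : mutually_independent P limit_index_ok (limit_family N Z).
Local Open Scope classical_set_scope.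

Lemma nat_rv_Alim i : (0 < i)%N -> nat_rv (Alim N Z i).
Proof.
move=> i0; apply: nat_rv_sum => l; rewrite -dvdn_divisors // => li.
have l0 := dvdn_gt0 i0 li.
apply: (nat_rv_diag (V := N l) (W := fun u t => (\sum_(1 <= r < u.+1) Z l r (i %/ l) t)%N)).
  exact: (HN l0).1.
move=> u; apply: nat_rv_sum => r; rewrite mem_index_iota => /andP[r0 _].
by apply: (HZ l0 r0 _).1; rewrite divn_gt0 // dvdn_leq.
Qed.

Lemma nat_rv_Xlim l q j : (0 < l)%N -> (0 < q)%N -> nat_rv (Xlim N Z l q j).
Proof.
move=> l0 q0.
apply: (nat_rv_diag (V := N l) (W := fun u t => (\sum_(1 <= r < u.+1) (Z l r q t == j))%N)).
  exact: (HN l0).1.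
move=> u; apply: nat_rv_sum => r; rewrite mem_index_iota => /andP[r0 _].
exact: (nat_rv_comp (fun c => (c == j) : nat) (HZ l0 r0 q0).1).
Qed.

Lemma expr_sumn (I : Type) (x : R) (s : seq I) (p : pred I) (f : I -> nat) :
  x ^+ (\sum_(i <- s | p i) f i)%N = \prod_(i <- s | p i) x ^+ f i.
Proof. by rewrite (big_morph (fun n => x ^+ n) (exprD x) (expr0 x)). Qed.

(** $A_i$ collects the $Z^{(l,r)}_q$ with $lq=i$; regrouping by $l$ turns dependent counts into
    compounds over disjoint sets of variables. *)
Lemma Alim_pow m (s : nat -> R) t : (forall l, (m < l)%N -> s l = 1) ->
  \prod_(1 <= i < m.+1) s i ^+ Alim N Z i t =
  \prod_(1 <= l < m.+1) compound N Z m (fun l q c => s (l * q)%N ^+ c) l t.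
Proof.
move=> s1; transitivity (\prod_(1 <= l < m.+1) \prod_(1 <= q < m.+1)
    \prod_(1 <= r < (N l t).+1) s (l * q)%N ^+ Z l r q t); last first.
  by apply: eq_bigr => l _; rewrite exchange_big.
rewrite -(prod_divisors (H := fun l q => \prod_(1 <= r < (N l t).+1) s (l * q)%N ^+ Z l r q t)).
  apply: eq_big_nat => i /andP[i0 _]; rewrite /Alim expr_sumn.
  apply: eq_big_seq => l; rewrite -dvdn_divisors // => li.
  by rewrite expr_sumn; apply: eq_bigr => r _; rewrite mulnC divnK.
by move=> l q mlq; rewrite big1 // => r _; rewrite s1 // expr1n.
Qed.

Lemma pgf_Alim m (s : nat -> R) : (forall l, 0 <= s l <= 1) ->
  (forall l, (m < l)%N -> s l = 1) ->
  mean P (fun t => \prod_(1 <= i < m.+1) s i ^+ Alim N Z i t) = iterated_exp m s.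
Proof.
move=> s01 s1; under eq_fun do rewrite Alim_pow //.
rewrite (mean_compound HN HZ Hind); first last.
- by apply/allP => l; rewrite mem_index_iota => /andP[].
- exact: iota_uniq.
- by move=> l q c; case/andP: (s01 (l * q)%N) => h0 h1; rewrite exprn_ge0 ?exprn_ile1.
rewrite /iterated_exp expR_sum big_add1 /= big_mkord; apply: eq_bigr => l _.
rewrite /compound_mean; suff -> : cluster_mean m (fun l q c => s (l * q)%N ^+ c) l.+1 =
  expR (\sum_(q < m) (s (l.+1 * q.+1)%N - 1) / q.+1%:R) by [].
rewrite /cluster_mean expR_sum big_add1 /= big_mkord; apply: eq_bigr => q _.
by rewrite poisson_mean_pow ?invr_gt0 ?ltr0n // mulrC.
Qed.

(** [S l] lists the pairs [(q, j)] under observation for [l], and [t] is indexed by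
    [(l, (q, j))]. *)
Definition X_factor (S : nat -> seq (nat * nat)) (t : nat * (nat * nat) -> R) l q c : R :=
  \prod_(p <- S l | p.1 == q) t (l, p) ^+ (c == p.2).

Lemma Xlim_pow (S : nat -> seq (nat * nat)) (t : nat * (nat * nat) -> R) m l w :
  (forall p, p \in S l -> 0 < p.1 <= m)%N ->
  \prod_(p <- S l) t (l, p) ^+ Xlim N Z l p.1 p.2 w = compound N Z m (X_factor S t) l w.
Proof.
move=> Sm; transitivity (\prod_(1 <= r < (N l w).+1) \prod_(p <- S l)
    t (l, p) ^+ (Z l r p.1 w == p.2)).
  by rewrite exchange_big; apply: eq_bigr => p _; rewrite /Xlim expr_sumn.
apply: eq_bigr => r _; rewrite /cluster /X_factor.
under [RHS]eq_bigr => q _ do rewrite big_mkcond.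
rewrite exchange_big /=; apply: eq_big_seq => p pS.
rewrite (bigD1_seq p.1) ?iota_uniq //=; last by rewrite mem_index_iota ltnS Sm.
by rewrite eqxx big1 ?mulr1 // => q; rewrite eq_sym => /negbTE ->.
Qed.

Lemma pgf_Xlim (L : seq nat) (S : nat -> seq (nat * nat)) (t : nat * (nat * nat) -> R) m :
  uniq L -> all (leq 1) L -> (forall i, 0 <= t i <= 1) ->
  (forall l p, l \in L -> p \in S l -> 0 < p.1 <= m)%N ->
  mean P (fun w => \prod_(l <- L) \prod_(p <- S l) t (l, p) ^+ Xlim N Z l p.1 p.2 w) =
  \prod_(l <- L) compound_mean m (X_factor S t) l.
Proof.
move=> uL L0 t01 Sm; rewrite -(mean_compound HN HZ Hind) //.
  congr mean; apply/funext => w; apply: eq_big_seq => l lL.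
  by apply: Xlim_pow => p; exact: Sm.
move=> l q c; rewrite /X_factor prodr_ge0 => [|p _]; last first.
  by rewrite exprn_ge0; case/andP: (t01 (l, p)).
by apply: prodr_ile1 => p _; case: (c == _); rewrite ?expr0 ?expr1 ?ler01 ?lexx.
Qed.

End LimitLaw.

(** * Limit theorem and laws of the counts *)

Section LimitTheorems.
Context {d : measure_display} {T : measurableType d} {R : realType}.
Variable P : probability T R.
Variables (N : nat -> T -> nat) (Z : nat -> nat -> nat -> T -> nat).
Hypothesis HN : forall l : nat, (0 < l)%N -> poisson_law P (N l) (l%:R)^-1.
Hypothesis HZ : forall l r q : nat, (0 < l)%N -> (0 < r)%N -> (0 < q)%N ->
  poisson_law P (Z l r q) (q%:R)^-1.
Hypothesis Hind : mutually_independent P limit_index_ok (limit_family N Z).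
Local Open Scope classical_set_scope.

Definition wreath_functional m (x : nat * nat) (phi : nat -> nat -> R) : R :=
  (\sum_(y : wreath_elt x.1 x.2)
     \prod_(i <- iota 0 m) phi i (cycle_count (wreath_perm y) i.+1))
  / (#|wreath_elt x.1 x.2|)%:R.

Lemma card_wreath_gt0 k n : 0 < (#|wreath_elt k n|)%:R :> R.
Proof. by rewrite ltr0n card_wreath_elt muln_gt0 expn_gt0 !fact_gt0. Qed.

Lemma multiaffine_wreath m x : multiaffine (iota 0 m) (wreath_functional m x).
Proof.
move=> phi i is_ _ f g c _ _ _ _; rewrite /wreath_functional mulrA -mulrDl; congr (_ / _).
have E h y : \prod_(j <- iota 0 m) upd phi i h j (cycle_count (wreath_perm y) j.+1) =
    h (cycle_count (wreath_perm y) i.+1) *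
    \prod_(j <- iota 0 m | j != i) phi j (cycle_count (wreath_perm y) j.+1).
  exact: (prod_upd phi h (fun j g => g (cycle_count (wreath_perm y) j.+1)) (iota_uniq _ _) is_).
by rewrite mulr_sumr -big_split /=; apply: eq_bigr => y _; rewrite !E; ring.
Qed.

Lemma subunital_wreath m x : subunital (wreath_functional m x).
Proof.
move=> phi phi01; rewrite /wreath_functional normrM normfV ger0_norm; last first.
  apply: sumr_ge0 => y _; apply: prodr_ge0 => i _.
  by case/andP: (phi01 i (cycle_count (wreath_perm y) i.+1)).
rewrite [`|_%:R|]ger0_norm ?ler0n // ler_pdivrMr ?card_wreath_gt0 // mul1r.
rewrite -sum1_card natr_sum; apply: ler_sum => y _.
by apply: prodr_ile1 => i _; exact: phi01.
Qed.

Lemma wreath_functional_pow m x (t : nat -> R) :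
  wreath_functional m x (fun i c => t i ^+ c) =
  unit_mean (fun l => if (0 < l <= m)%N then t l.-1 else 1) x.1 x.2.
Proof.
rewrite /wreath_functional /unit_mean /wreath_mean /wreath_sum; congr (_ / _).
by apply: eq_bigr => y _; rewrite cycle_count_pow.
Qed.

Lemma wreath_functional_indic m x (c : nat -> nat) :
  wreath_functional m x (fun i => nat_indic (c i.+1)) = wreath_prob x.1 x.2 m c.
Proof.
rewrite /wreath_functional /wreath_prob; congr (_ / _).
rewrite -sum1_card natr_sum [RHS]big_mkcond; apply: eq_bigr => y _ /=.
have -> : iota 0 m = index_iota 0 m by rewrite /index_iota subn0.
rewrite big_mkord; case: ifPn => [/set_mem /= /forallP yc|ync].
  by rewrite big1 // => i _; rewrite /nat_indic yc.
have /forallPn[i yci] : ~~ [forall i : 'I_m, cycle_count (wreath_perm y) i.+1 == c i.+1].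
  by apply: contra ync => yc; exact: mem_set.
by rewrite (bigD1 i) //= /nat_indic (negbTE yci) mul0r.
Qed.

Lemma Alim_event m (c : nat -> nat) :
  [set t | forall i : 'I_m, Alim N Z i.+1 t = c i.+1] =
  \big[setI/setT]_(i <- iota 0 m) [set t | Alim N Z i.+1 t = c i.+1].
Proof.
rewrite -bigcap_seq; apply/seteqP; split=> t /= H i.
  by rewrite /= mem_iota => /andP[_ im]; exact: (H (Ordinal im)).
by apply: H; rewrite /= mem_iota /=.
Qed.

Lemma wreath_prob_cvg m (c : nat -> nat) :
  wreath_prob x.1 x.2 m c
    - fine (P [set t | forall i : 'I_m, Alim N Z i.+1 t = c i.+1])
  @[x --> filter_prod \oo \oo] --> 0.
Proof.
have mA i : i \in iota 0 m -> nat_rv (Alim N Z i.+1) by move=> _; exact: (nat_rv_Alim HN HZ).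
pose D2 (_ : nat * nat) (phi : nat -> nat -> R) :=
  mean P (fun t => \prod_(i <- iota 0 m) phi i (Alim N Z i.+1 t)).
have := @multi_cvg_indicators R nat (iota 0 m) _ (filter_prod \oo \oo) _
  (wreath_functional m) D2 (@multiaffine_wreath m) (fun=> multiaffine_mean_prod P (iota_uniq _ _) mA)
  (@subunital_wreath m) (fun=> subunital_mean_prod P mA) _ (fun i => c i.+1) (fun=> 2^-1).
have t01 (i : nat) : 0 < (2^-1 : R) < 1 by apply/andP; split; lra.
move=> /(_ _ _ t01) H.
rewrite Alim_event -(mean_prod_indic P (fun i => c i.+1) mA).
have E1 : (fun x : nat * nat =>
    wreath_functional m x (mixed_family (iota 0 m) (fun i => c i.+1) (fun=> 2^-1))
    - D2 x (mixed_family (iota 0 m) (fun i => c i.+1) (fun=> 2^-1))) =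
  (fun x => wreath_prob x.1 x.2 m c -
    mean P (fun t => \prod_(i <- iota 0 m) nat_indic (c i.+1) (Alim N Z i.+1 t))).
  apply/funext => x; rewrite -wreath_functional_indic; congr (_ - _).
    rewrite /wreath_functional; congr (_ / _); apply: eq_bigr => y _.
    exact: (prod_half_family _ _ (fun i g => g (cycle_count (wreath_perm y) i.+1))).
  congr mean; apply/funext => t.
  exact: (prod_half_family _ _ (fun i g => g (Alim N Z i.+1 t))).
rewrite -E1; apply: H => t {}t01.
(* Cycles of length [l] are counted in coordinate [l.-1]; lengths outside [1..m] get weight [1], as
   both limit formulas require. *)
pose s l := if (0 < l <= m)%N then t l.-1 else 1.
have s01 l : 0 <= s l <= 1.
  rewrite /s; case: ifP => _; last by rewrite ler01 lexx.
  by case/andP: (t01 l.-1) => /ltW -> /ltW ->.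
have s1 l : (m < l)%N -> s l = 1 by rewrite /s ltnNge => /negbTE ->; rewrite andbF.
have D2E x : D2 x (fun i c => t i ^+ c) = iterated_exp m s.
  rewrite -(pgf_Alim HN HZ Hind s01 s1); congr mean; apply/funext => w.
  have -> : iota 0 m = index_iota 0 m by rewrite /index_iota subn0.
  by rewrite [RHS]big_add1 /=; apply: eq_big_nat => i /andP[_ im]; rewrite /s im.
rewrite -(subrr (iterated_exp m s)).
under eq_fun do rewrite wreath_functional_pow D2E.
by apply: cvgB; [exact: unit_mean_wreath_cvg|exact: cvg_cst].
Qed.

Lemma poisson_pmf_inv q j : (0 < q)%N -> poisson_pmf (q%:R^-1) j = pqj q j :> R.
Proof. by move=> q0; rewrite /poisson_pmf /pqj invr_gt0 ltr0n q0; ring. Qed.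

Lemma pqj_gt0 q j : (0 < q)%N -> 0 < pqj q j :> R.
Proof.
move=> q0; rewrite /pqj !mulr_gt0 ?expR_gt0 ?invr_gt0 ?ltr0n ?fact_gt0 //.
by rewrite exprn_gt0 // invr_gt0 ltr0n.
Qed.

(** Poisson thinning: each of the $N_l$ copies has $Z_q=j$ with probability $p^q_j$, and the
    generating function $\exp(\frac1l\sum_j p^q_j(t_j-1))$ splits into Poisson factors over [j]. *)
Lemma X_joint_law l q s (v : nat -> nat) : (0 < l)%N -> (0 < q)%N -> uniq s ->
  P (\big[setI/setT]_(j <- s) [set t | Xlim N Z l q j t = v j]) =
  (\prod_(j <- s) poisson_pmf (pqj q j / l%:R) (v j))%:E.
Proof.
move=> l0 q0 us.
have mX j : j \in s -> nat_rv (Xlim N Z l q j) by move=> _; exact: (nat_rv_Xlim HN HZ).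
have lam0 j : 0 < pqj q j / l%:R :> R by rewrite divr_gt0 ?pqj_gt0 ?ltr0n.
rewrite -[LHS]fineK; last first.
  apply: fin_num_measure; rewrite big_seq; elim/big_rec: _ => // j B js mB.
  by apply: measurableI => //; exact: mX.
congr (_%:E); rewrite -mean_prod_indic //.
pose D2 (phi : nat -> nat -> R) := \prod_(j <- s) poisson_mean (pqj q j / l%:R) (phi j).
have aD2 : multiaffine s D2.
  move=> phi i is_ _ f g c c01 f01 g01 fg01; rewrite /D2.
  rewrite !(prod_upd _ _ (fun j => poisson_mean (pqj q j / l%:R)) us is_).
  by rewrite poisson_mean_affine //; ring.
have sD2 : subunital D2.
  move=> phi phi01; rewrite /D2 ger0_norm.
    by apply: prodr_ile1 => j _; exact: poisson_mean_itv.
  by apply: prodr_ge0 => j _; case/andP: (poisson_mean_itv (lam0 j) (phi01 j)).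
have := eq_indicators v (multiaffine_mean_prod P us mX) aD2 (subunital_mean_prod P mX) sD2.
rewrite /D2 (prod_half_family _ _ (fun j => poisson_mean (pqj q j / l%:R))).
have -> : (fun w => \prod_(j <- s) half_family R s v j (Xlim N Z l q j w)) =
    (fun w => \prod_(j <- s) nat_indic (v j) (Xlim N Z l q j w)).
  by apply/funext => w; exact: (prod_half_family _ _ (fun i g => g (Xlim N Z l q i w))).
move=> ->; first by apply: eq_bigr => j _; rewrite poisson_mean_indic.
move=> t t01.
have t01' j : 0 <= t j <= 1 by case/andP: (t01 j) => /ltW -> /ltW ->.
pose S (_ : nat) := [seq (q, j) | j <- s].
pose t' (i : nat * (nat * nat)) := t i.2.2.
have := @pgf_Xlim _ _ _ P N Z HN HZ Hind [:: l] S t' q isT _ (fun i => t01' i.2.2).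
rewrite /= l0 => /(_ isT) => H.
transitivity (mean P (fun w => \prod_(l' <- [:: l]) \prod_(p <- S l')
  t' (l', p) ^+ Xlim N Z l' p.1 p.2 w)).
  by congr mean; apply/funext => w; rewrite big_seq1 big_map.
rewrite H; last by move=> l' p _ /mapP[j _ ->] /=; rewrite q0 leqnn.
rewrite big_seq1 /compound_mean /cluster_mean.
(* Only the coordinate [q' = q] is observed; the others contribute [1]. *)
have -> : \prod_(1 <= q' < q.+1) poisson_mean q'%:R^-1 (X_factor S t' l q') =
    1 + \sum_(j <- s) pqj q j * (t j - 1).
  rewrite big_nat_recr //= big1_seq ?mul1r; last first.
    move=> q' /andP[_]; rewrite mem_index_iota => /andP[q'0 q'q].
    rewrite (_ : X_factor S t' l q' = fun=> 1).
      by rewrite poisson_mean1 // invr_gt0 ltr0n.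
    apply/funext => c; rewrite /X_factor big_map big_pred0 // => j /=.
    by rewrite gtn_eqF.
  rewrite (_ : X_factor S t' l q = fun c => \prod_(j <- s) t j ^+ (c == j)).
    rewrite poisson_mean_cases ?invr_gt0 ?ltr0n //; congr (1 + _).
    by apply: eq_bigr => j _; rewrite poisson_pmf_inv.
  by apply/funext => c; rewrite /X_factor big_map /=; apply: eq_bigl => j; rewrite eqxx.
rewrite addrAC subrr add0r mulr_suml expR_sum; apply: eq_bigr => j _.
by rewrite poisson_mean_pow // mulrAC.
Qed.

End LimitTheorems.

Section BlockStructure.
Context {d : measure_display} {T : measurableType d} {R : realType}.
Variable P : probability T R.
Variables (N : nat -> T -> nat) (Z : nat -> nat -> nat -> T -> nat).
Hypothesis HN : forall l : nat, (0 < l)%N -> poisson_law P (N l) (l%:R)^-1.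
Hypothesis HZ : forall l r q : nat, (0 < l)%N -> (0 < r)%N -> (0 < q)%N ->
  poisson_law P (Z l r q) (q%:R)^-1.
Hypothesis Hind : mutually_independent P limit_index_ok (limit_family N Z).
Local Open Scope classical_set_scope.

Lemma Xlim_poisson l q j : (0 < l)%N -> (0 < q)%N ->
  poisson_law P (Xlim N Z l q j) (pqj q j / l%:R).
Proof.
move=> l0 q0; split=> [|v]; first exact: (nat_rv_Xlim HN HZ).
by have := X_joint_law HN HZ Hind (s := [:: j]) (fun=> v) l0 q0 isT; rewrite !big_seq1.
Qed.

Lemma Xlim_independent l q : (0 < l)%N -> (0 < q)%N ->
  mutually_independent P (fun j : nat => (0 < j)%N) (Xlim N Z l q).
Proof.
move=> l0 q0; split=> [j _|s v us _]; first exact: (nat_rv_Xlim HN HZ).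
rewrite (X_joint_law HN HZ Hind) // -prodEFin; apply: eq_bigr => j _.
by have [_ ->] := Xlim_poisson j l0 q0.
Qed.

Lemma big_setI_undup (I : eqType) (s : seq I) (A : I -> set T) :
  \big[setI/setT]_(i <- undup s) A i = \big[setI/setT]_(i <- s) A i.
Proof.
by rewrite big_undup //; exact: setIid.
Qed.

(** The joint generating function is a product of compound means, one for each [l], and each of
    these is the generating function of a single family. The identity passes to indicators on the
    flattened list of pairs [(l, p)]. *)
Lemma Xlim_blocks_independent :
  independent_families P (fun l : nat => (0 < l)%N)
    (fun p : nat * nat => (0 < p.1)%N && (0 < p.2)%N)
    (fun l p => Xlim N Z l p.1 p.2).
Proof.
(* A repeated index repeats the same event, while multiaffinity needs a list without duplicates. *)
move=> L S0 v uL L0 S00; pose S l := undup (S0 l).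
under eq_bigr => l _ do rewrite -big_setI_undup.
under [RHS]eq_bigr => l _ do rewrite -big_setI_undup.
have S0P l p : p \in S l -> (0 < p.1)%N.
  by rewrite mem_undup => /(allP (S00 l)) /andP[].
have L0P l : l \in L -> (0 < l)%N by exact: (allP L0).
pose W (i : nat * (nat * nat)) := Xlim N Z i.1 i.2.1 i.2.2.
pose s : seq (nat * (nat * nat)) := [seq (l, p) | l <- L, p <- S l].
have us : uniq s.
  apply: allpairs_uniq_dep => //; first by move=> l _; exact: undup_uniq.
  by move=> [l p] [l' p'] _ _ /= [-> ->].
have mW i : i \in s -> nat_rv (W i).
  by move=> /allpairsPdep[l [p [lL pS ->]]]; apply: (nat_rv_Xlim HN HZ); [exact: L0P|exact: S0P pS].
have mWl l : l \in L -> forall p, p \in S l -> nat_rv (Xlim N Z l p.1 p.2).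
  by move=> lL p pS; apply: (nat_rv_Xlim HN HZ); [exact: L0P|exact: S0P pS].
pose v' (i : nat * (nat * nat)) := v i.1 i.2.
pose H l (phi : nat * (nat * nat) -> nat -> R) :=
  mean P (fun w => \prod_(p <- S l) phi (l, p) (Xlim N Z l p.1 p.2 w)).
pose D2 phi := \prod_(l <- L) H l phi.
have aD2 : multiaffine s D2.
  move=> phi i /allpairsPdep[l [p [lL pS ->]]] phi01 f g c c01 f01 g01 fg01.
  have uE h l' p' : upd phi (l, p) h (l', p') = upd (fun p => phi (l', p)) p
      (if l' == l then h else phi (l', p)) p'.
    rewrite /upd xpair_eqE; case: eqP => [->|_] /=; first by [].
    by case: eqP => // ->.
  have E h : D2 (upd phi (l, p) h) = mean P (fun w => \prod_(p' <- S l)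
      upd (fun p => phi (l, p)) p h p' (Xlim N Z l p'.1 p'.2 w)) *
      \prod_(l' <- L | l' != l) H l' phi.
    rewrite /D2 (bigD1_seq l) //=; congr (_ * _).
      congr mean; apply/funext => w; apply: eq_bigr => p' _.
      by rewrite uE eqxx.
    apply: eq_bigr => l' l'l; congr mean; apply/funext => w; apply: eq_bigr => p' _.
    by rewrite uE (negbTE l'l) /upd; case: eqP => // ->.
  rewrite !E.
  have phil01 p' : unit_valued (phi (l, p')) by exact: phi01.
  have := multiaffine_mean_prod P (undup_uniq _) (mWl l lL) pS phil01 c01 f01 g01 fg01.
  by move=> ->; ring.
have H01 l phi : l \in L -> (forall i, unit_valued (phi i)) -> 0 <= H l phi <= 1.
  by move=> lL phi01; exact: (unital_mean_prod P (phi := fun p => phi (l, p)) (mWl l lL)).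
have sD2 : subunital D2.
  move=> phi phi01; rewrite /D2 big_seq ger0_norm.
    by apply: prodr_ile1 => l lL; exact: H01.
  by apply: prodr_ge0 => l lL; case/andP: (H01 l phi lL phi01).
have flat (F : nat * (nat * nat) -> R) :
    \prod_(i <- s) F i = \prod_(l <- L) \prod_(p <- S l) F (l, p).
  by rewrite big_allpairs_dep.
have mev l : l \in L ->
    measurable (\big[setI/setT]_(p <- S l) [set t | Xlim N Z l p.1 p.2 t = v l p]).
  move=> lL; rewrite big_seq; elim/big_rec: _ => // p B pS mB; apply: measurableI => //.
  exact: mWl.
have evE : \big[setI/setT]_(l <- L) \big[setI/setT]_(p <- S l)
      [set t | Xlim N Z l p.1 p.2 t = v l p]
   = \big[setI/setT]_(i <- s) [set t | W i t = v' i].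
  by rewrite big_allpairs_dep.
rewrite -[LHS]fineK; last first.
  apply: fin_num_measure; rewrite big_seq; elim/big_rec: _ => // l B lL mB.
  by apply: measurableI => //; exact: mev.
rewrite [RHS](eq_big_seq (fun l => (fine (P (\big[setI/setT]_(p <- S l)
  [set t | Xlim N Z l p.1 p.2 t = v l p])))%:E)); last first.
  by move=> l lL; rewrite fineK //; apply: fin_num_measure; exact: mev.
rewrite prodEFin evE; congr (_%:E); rewrite -mean_prod_indic //.
have := eq_indicators v' (multiaffine_mean_prod P us mW) aD2 (subunital_mean_prod P mW) sD2.
have -> : (fun w => \prod_(i <- s) half_family R s v' i (W i w)) =
    (fun w => \prod_(i <- s) nat_indic (v' i) (W i w)).
  by apply/funext => w; exact: (prod_half_family _ _ (fun i g => g (W i w))).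
move=> ->.
  apply: eq_big_seq => l lL; rewrite -mean_prod_indic; last exact: mWl.
  congr mean; apply/funext => w; apply: eq_big_seq => p pS.
  by rewrite /half_family /mixed_family (_ : (l, p) \in s) //; apply/allpairsPdep; exists l, p.
move=> t t01.
have t01' i : 0 <= t i <= 1 by case/andP: (t01 i) => /ltW -> /ltW ->.
pose m := (\max_(l <- L) \max_(p <- S l) p.1)%N.
have Sm l p : l \in L -> p \in S l -> (0 < p.1 <= m)%N.
  move=> lL pS; rewrite (S0P l p pS) /=.
  exact: leq_trans (leq_bigmax_seq p pS isT) (leq_bigmax_seq l lL isT).
have -> : (fun w => \prod_(i <- s) t i ^+ W i w) =
    (fun w => \prod_(l <- L) \prod_(p <- S l) t (l, p) ^+ Xlim N Z l p.1 p.2 w).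
  by apply/funext => w; rewrite flat.
rewrite (pgf_Xlim HN HZ Hind uL L0 t01' Sm); apply: eq_big_seq => l lL.
have l1 : all (leq 1) [:: l] by rewrite /= L0P.
have Sm' l' p : l' \in [:: l] -> p \in S l' -> (0 < p.1 <= m)%N.
  by rewrite inE => /eqP -> pS; exact: (Sm l p lL pS).
have := pgf_Xlim HN HZ Hind (L := [:: l]) isT l1 t01' Sm'; rewrite big_seq1 => <-.
by congr mean; apply/funext => w; rewrite big_seq1.
Qed.

Lemma Alim_by_values i t : (0 < i)%N -> exists M : nat, forall M' : nat, (M <= M')%N ->
  Alim N Z i t
  = (\sum_(l <- divisors i) \sum_(1 <= j < M') j * Xlim N Z l (i %/ l) j t)%N.
Proof.
(* Above every value of [Z] that enters $A_i$ at [t], so each copy is counted exactly at its own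
   value [j]. *)
move=> i0; exists (\max_(l <- divisors i) \max_(1 <= r < (N l t).+1) Z l r (i %/ l) t)%N.+1.
move=> M' MM'; apply: eq_big_seq => l li; rewrite /Xlim.
under [RHS]eq_bigr => j _ do rewrite big_distrr /=.
rewrite exchange_big /=; apply: eq_big_seq => r rN; set z := Z l r (i %/ l)%N t.
have zM : (z < M')%N.
  apply: leq_ltn_trans MM'.
  exact: leq_trans (leq_bigmax_seq r rN isT) (leq_bigmax_seq l li isT).
case: (posnP z) => [->|z0].
  rewrite big1_seq // => j; rewrite mem_index_iota => /andP[_ /andP[j0 _]].
  by rewrite eq_sym gtn_eqF ?muln0.
rewrite (bigD1_seq z) ?iota_uniq ?mem_index_iota ?z0 //= eqxx muln1 big1 ?addn0 // => j jz.
by rewrite eq_sym (negbTE jz) muln0.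
Qed.

End BlockStructure.

(** * Moments *)

Section ExponentialExpansion.
Variables (R : realType).
Local Open Scope classical_set_scope.

(** The remainder is at most $|x|^3\sum_{j\ge3}1/j!$, whence the constant. *)
Lemma expR_cubic (x : R) : `|x| <= 1 ->
  `|expR x - (1 + x + x ^+ 2 / 2)| <= expR 1 * `|x| ^+ 3.
Proof.
move=> x1; have s3 : series (exp_coeff x) 3 = 1 + x + x ^+ 2 / 2.
  rewrite /series /= !big_nat_recr //= big_nil /exp_coeff /= !factS fact0 expr0 expr1.
  by field.
rewrite -s3.
have c : `|series (exp_coeff x) n - series (exp_coeff x) 3| @[n --> \oo] -->
         `|expR x - series (exp_coeff x) 3|.
  by apply: cvg_norm; apply: cvgB; [exact: cvg_series_exp_coeff|exact: cvg_cst].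
apply: (ler_cvg_to c (cvg_cst _)).
exists 3 => // n /= n3; rewrite sub_series n3.
apply: le_trans (ler_norm_sum _ _ _) _.
apply: (@le_trans _ _ (\sum_(3 <= j < n) exp_coeff 1 j * `|x| ^+ 3)).
  apply: ler_sum_nat => j /andP[j3 _].
  rewrite /exp_coeff /= expr1n normrM normrX normfV [`|(j`!)%:R|]ger0_norm ?ler0n //.
  rewrite div1r mulrC ler_wpM2l ?invr_ge0 ?ler0n //.
  by rewrite -(subnK j3) exprD ler_piMl ?exprn_ge0 // exprn_ile1.
rewrite -mulr_suml ler_wpM2r ?exprn_ge0 //.
apply: le_trans (series_exp_coeff1_le R n).
rewrite /series /= (@big_cat_nat _ _ _ 3 0 n) //= lerDr.
by apply: sumr_ge0 => j _; rewrite exp_coeff_ge0.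
Qed.

(** Stated along sequences because it serves twice: for the inner exponentials, linear in [e n], and
    for the outer one, whose argument is only known asymptotically. *)
Lemma expR_second_order (x e : nat -> R) (y : R) : (forall n, 0 < e n) ->
  e n @[n --> \oo] --> 0 -> x n / e n @[n --> \oo] --> y ->
  (expR (x n) - 1 - x n) / e n ^+ 2 @[n --> \oo] --> y ^+ 2 / 2.
Proof.
move=> e0 ec xc; pose z n := x n / e n.
have xE n : x n = z n * e n by rewrite /z divfK // gt_eqF.
have xc0 : x n @[n --> \oo] --> 0.
  rewrite -(mulr0 y); under eq_fun do rewrite xE; exact: cvgM.
have zc2 : z n ^+ 2 / 2 @[n --> \oo] --> y ^+ 2 / 2.
  by apply: cvgMl; rewrite expr2; under eq_fun do rewrite expr2; exact: cvgM.
have bc : expR 1 * (`|z n| ^+ 3 * e n) @[n --> \oo] --> 0.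
  rewrite -(mulr0 (expR 1)); apply: cvgMr; rewrite -(mulr0 (`|y| ^+ 3)); apply: cvgM => //.
  have nc : `|z n| @[n --> \oo] --> `|y| by exact: cvg_norm.
  rewrite !exprS expr0 mulr1; under eq_fun do rewrite !exprS expr0 mulr1.
  by apply: cvgM => //; exact: cvgM.
suff dc : (expR (x n) - 1 - x n) / e n ^+ 2 - z n ^+ 2 / 2 @[n --> \oo] --> 0.
  rewrite -[X in _ --> X]add0r.
  rewrite (_ : (fun n => _) = (fun n =>
    ((expR (x n) - 1 - x n) / e n ^+ 2 - z n ^+ 2 / 2) + z n ^+ 2 / 2)).
    exact: cvgD.
  by apply/funext => n; rewrite subrK.
apply/norm_cvg0P; apply: (squeeze_cvgr _ (cvg_cst 0) bc).
near=> n; rewrite normr_ge0 /=.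
have x1 : `|x n| <= 1 by near: n; exact: (cvgr0_norm_le _ xc0 _ ltr01).
have -> : (expR (x n) - 1 - x n) / e n ^+ 2 - z n ^+ 2 / 2 =
   (expR (x n) - (1 + x n + x n ^+ 2 / 2)) / e n ^+ 2.
  by rewrite /z; field; rewrite gt_eqF.
have e2 : 0 < e n ^+ 2 by exact: exprn_gt0.
rewrite [leLHS]normrM [X in _ * X <= _]normfV [`|e n ^+ 2|]gtr0_norm // ler_pdivrMr //.
apply: le_trans (expR_cubic x1) _.
rewrite -!mulrA ler_wpM2l ?expR_ge0 // {1}xE normrM [`|e n|]gtr0_norm // exprMn.
by rewrite [leRHS](_ : _ = `|z n| ^+ 3 * e n ^+ 3) //; ring.
Unshelve. all: by end_near. Qed.

End ExponentialExpansion.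

(** * Moments from the expansion of a generating function at 1 *)

Section MomentsFromPgf.
Context {d : measure_display} {T : measurableType d} {R : realType}.
Variables (P : probability T R) (A : T -> nat) (mu beta : R).
Local Open Scope classical_set_scope.
Hypothesis mA : nat_rv A.

(** With [n.+2] the argument [1 - harm n] lies strictly between [0] and [1] for every [n]. *)
Definition harm n : R := n.+2%:R^-1.

Lemma harm_gt0 n : 0 < harm n. Proof. by rewrite invr_gt0 ltr0n. Qed.

Lemma harm_lt1 n : harm n < 1.
Proof. by rewrite invf_lt1 ?ltr0n // ltr1n. Qed.

Lemma harm_noninc n n' : (n <= n')%N -> harm n' <= harm n.
Proof. by move=> nn; rewrite lef_pV2 ?posrE ?ltr0n // ler_nat. Qed.

Lemma cvg_harm : harm n @[n --> \oo] --> 0.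
Proof.
rewrite (_ : harm = fun n => (harmonic (n + 1)%N)); last first.
  by apply/funext => n; rewrite /harm /harmonic /= addn1.
by rewrite (cvg_shiftn 1 (@harmonic R)); exact: cvg_harmonic.
Qed.

Lemma pow_harm_itv n u : 0 <= (1 - harm n) ^+ u <= 1.
Proof.
have := harm_gt0 n; have := harm_lt1 n => h1 h0.
by rewrite exprn_ge0 ?exprn_ile1 //; lra.
Qed.

Lemma cvg_pow_harm u : (1 - harm n) ^+ u @[n --> \oo] --> (1 : R).
Proof.
elim: u => [|u IH]; first by under eq_fun do rewrite expr0; exact: cvg_cst.
under eq_fun do rewrite exprS.
have c1 : 1 - harm n @[n --> \oo] --> (1 - 0 : R).
  by apply: cvgB; [exact: cvg_cst|exact: cvg_harm].
have : (1 - harm n) * (1 - harm n) ^+ u @[n --> \oo] --> (1 - 0) * (1 : R) by exact: cvgM.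
by rewrite subr0 mulr1.
Qed.

Lemma pow_harm_nondec n n' u : (n <= n')%N -> (1 - harm n) ^+ u <= (1 - harm n') ^+ u.
Proof.
move=> nn; have := harm_gt0 n; have := harm_lt1 n => h1 h0.
by rewrite lerXn2r ?nnegrE ?lerB ?harm_noninc //; [lra|have := harm_lt1 n'; lra].
Qed.

(** [geom1] and [geom2] are the first and second difference quotients of $x^c$ at $x=1$. As
    geometric sums they are visibly nonnegative and increasing in [n], so monotone convergence
    yields the moments without prior integrability of [A]. *)
Definition geom1 n c : R := \sum_(u < c) (1 - harm n) ^+ u.

Definition geom2 n c : R := \sum_(u < c) geom1 n u.

Lemma geom1E n c : geom1 n c = (1 - (1 - harm n) ^+ c) / harm n.
Proof.
have h0 : harm n != 0 by rewrite gt_eqF ?harm_gt0.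
rewrite /geom1; elim: c => [|c IH]; first by rewrite big_ord0 expr0 subrr mul0r.
by rewrite big_ord_recr /= IH exprS; field.
Qed.

Lemma geom2E n c : geom2 n c = (c%:R - geom1 n c) / harm n.
Proof.
have h0 : harm n != 0 by rewrite gt_eqF ?harm_gt0.
rewrite /geom2; elim: c => [|c IH]; first by rewrite big_ord0 /geom1 big_ord0 subrr mul0r.
by rewrite big_ord_recr /= IH !geom1E exprS -natr1; field.
Qed.

(** $\binom c2$, kept as a sum to be the termwise limit of [geom2]. *)
Definition pairs_below c : R := \sum_(u < c) u%:R.

Lemma pairs_belowE c : c%:R ^+ 2 = 2 * pairs_below c + c%:R.
Proof.
rewrite /pairs_below; elim: c => [|c IH]; first by rewrite big_ord0 expr0n mulr0 addr0.
rewrite big_ord_recr /= mulrDr addrAC [2 * _ + _]addrC.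
have -> : 2 * \sum_(u < c) u%:R = c%:R ^+ 2 - c%:R :> R by rewrite IH; ring.
by rewrite -natr1; ring.
Qed.

Lemma geom1_ge0 n c : 0 <= geom1 n c.
Proof. by apply: sumr_ge0 => u _; case/andP: (pow_harm_itv n u). Qed.

Lemma geom2_ge0 n c : 0 <= geom2 n c.
Proof. by apply: sumr_ge0 => u _; exact: geom1_ge0. Qed.

Lemma cvg_sum_ord (f : nat -> nat -> R) (l : nat -> R) c :
  (forall u, f u n @[n --> \oo] --> l u) ->
  \sum_(u < c) f u n @[n --> \oo] --> \sum_(u < c) l u.
Proof. by move=> fl; apply: cvg_big => [|u _]; [exact: add_continuous|exact: fl]. Qed.

Lemma cvg_geom1 c : geom1 n c @[n --> \oo] --> (c%:R : R).
Proof.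
have := @cvg_sum_ord (fun u n => (1 - harm n) ^+ u) (fun=> 1) c cvg_pow_harm.
by rewrite sumr_const card_ord.
Qed.

Lemma cvg_geom2 c : geom2 n c @[n --> \oo] --> pairs_below c.
Proof. exact: (@cvg_sum_ord (fun u n => geom1 n u) (fun u => u%:R) c cvg_geom1). Qed.

Lemma measurable_nat_rv (f : nat -> R) : measurable_fun setT (fun t => f (A t)).
Proof. by move=> _ B mB; rewrite setTI; exact: (nat_rv_preimage (f @^-1` B) mA). Qed.

Lemma monotone_cvg_nat (f : nat -> nat -> R) (h : nat -> R) :
  (forall n c, 0 <= f n c) -> (forall c n n', (n <= n')%N -> f n c <= f n' c) ->
  (forall c, f n c @[n --> \oo] --> h c) ->
  (\int[P]_t (f n (A t))%:E)%E @[n --> \oo] --> (\int[P]_t (h (A t))%:E)%E.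
Proof.
move=> f0 fn fh.
have -> : (\int[P]_t (h (A t))%:E = \int[P]_t limn (fun n => (f n (A t))%:E))%E.
  apply: eq_integral => t _; apply/esym/cvg_lim => //.
  by apply: cvg_EFin; [exact: nearW|exact: fh].
apply: cvg_monotone_convergence => //.
- by move=> n; apply/measurable_EFinP; exact: measurable_nat_rv.
- by move=> n t _; rewrite lee_fin.
- by move=> t _ n n' nn; rewrite lee_fin fn.
Qed.

Lemma integrable_nat_rv (f : nat -> R) m : (forall c, 0 <= f c) ->
  (\int[P]_t (f (A t))%:E)%E = m%:E -> P.-integrable setT (EFin \o (fun t => f (A t))).
Proof.
move=> f0 fm; apply/integrableP; split.
  by apply/measurable_EFinP; exact: measurable_nat_rv.
under eq_integral => t _ do rewrite /= ger0_norm //.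
by rewrite fm ltry.
Qed.

Let g n := mean P (fun t => (1 - harm n) ^+ A t).

Lemma integral_geom1 n : (\int[P]_t (geom1 n (A t))%:E)%E = ((1 - g n) / harm n)%:E.
Proof.
have uA : unital_rv (fun t => (1 - harm n) ^+ A t).
  exact: (unital_nat_rv (g := fun c => (1 - harm n) ^+ c) mA (pow_harm_itv n)).
have u1 : unital_rv (fun _ : T => 1 : R) by apply: unital_cst; rewrite ler01 lexx.
have uB : unital_rv (fun t => 1 - (1 - harm n) ^+ A t).
  apply: (unital_nat_rv (g := fun c => 1 - (1 - harm n) ^+ c) mA) => c.
  by case/andP: (pow_harm_itv n c) => h0 h1; apply/andP; split; lra.
have iB := unital_integrable P uB.
under eq_integral => t _ do rewrite geom1E mulrC EFinM.
rewrite integralZl //= mulrC EFinM; congr (_ * _)%E.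
transitivity (mean P (fun t => 1 - (1 - harm n) ^+ A t))%:E.
  by rewrite fineK //; exact: integrable_fin_num iB.
congr (_%:E); rewrite (_ : (fun t => _) = (fun t => 1 + (-1) * (1 - harm n) ^+ A t)).
  by rewrite mean_affine // mean_cst mulN1r.
by apply/funext => t; rewrite mulN1r.
Qed.

(** Together with [g2] this says $g = 1-\mu h+\beta h^2+o(h^2)$ along [h = harm n]; then $\mu=E[A]$
    and $\beta=E[\binom A2]$. *)
Hypothesis g1 : (1 - g n) / harm n @[n --> \oo] --> mu.
Hypothesis g2 : (g n - 1 + mu * harm n) / harm n ^+ 2 @[n --> \oo] --> beta.

Lemma first_moment : (\int[P]_t (A t)%:R%:E)%E = mu%:E.
Proof.
have nd k n n' : (n <= n')%N -> geom1 n k <= geom1 n' k.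
  by move=> nn; apply: ler_sum => u _; exact: pow_harm_nondec.
have c := monotone_cvg_nat geom1_ge0 nd cvg_geom1.
have E : (fun n => \int[P]_t (geom1 n (A t))%:E)%E = (fun n => ((1 - g n) / harm n)%:E).
  by apply/funext => n; exact: integral_geom1.
rewrite E in c; apply: (cvg_unique _ c) => //.
by apply: cvg_EFin; [exact: nearW|exact: g1].
Qed.

Lemma integral_geom2 n :
  (\int[P]_t (geom2 n (A t))%:E)%E = ((g n - 1 + mu * harm n) / harm n ^+ 2)%:E.
Proof.
have iA : P.-integrable setT (EFin \o (fun t => (A t)%:R)).
  by apply: (integrable_nat_rv (f := fun c => c%:R)) first_moment => c; exact: ler0n.
have iG := integrable_nat_rv (geom1_ge0 n) (integral_geom1 n).
under eq_integral => t _ do rewrite geom2E mulrC EFinM.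
rewrite integralZl //=; last first.
  rewrite (_ : (fun t => _) =
    (EFin \o (fun t => (A t)%:R)) \- (EFin \o (fun t => geom1 n (A t))))%E //.
  exact: integrableB.
under eq_integral => t _ do rewrite EFinB.
rewrite integralB_EFin // first_moment integral_geom1 -EFinB -EFinM; congr (_%:E).
by field; rewrite gt_eqF ?harm_gt0.
Qed.

Lemma second_factorial_moment : (\int[P]_t (pairs_below (A t))%:E)%E = beta%:E.
Proof.
have nd k n n' : (n <= n')%N -> geom2 n k <= geom2 n' k.
  by move=> nn; apply: ler_sum => u _; apply: ler_sum => v _; exact: pow_harm_nondec.
have c := monotone_cvg_nat geom2_ge0 nd cvg_geom2.
have E : (fun n => \int[P]_t (geom2 n (A t))%:E)%E =
    (fun n => ((g n - 1 + mu * harm n) / harm n ^+ 2)%:E).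
  by apply/funext => n; exact: integral_geom2.
rewrite E in c; apply: (cvg_unique _ c) => //.
by apply: cvg_EFin; [exact: nearW|exact: g2].
Qed.

Lemma pairs_below_ge0 c : 0 <= pairs_below c.
Proof. by apply: sumr_ge0 => u _; exact: ler0n. Qed.

Lemma pgf_expectation : ('E_P[fun t => (A t)%:R] = mu%:E)%E.
Proof. by rewrite unlock first_moment. Qed.

Lemma pgf_variance : ('V_P[fun t => (A t)%:R] = (2 * beta + mu - mu ^+ 2)%:E)%E.
Proof.
have iA : P.-integrable setT (EFin \o (fun t => (A t)%:R)).
  by apply: (integrable_nat_rv (f := fun c => c%:R)) first_moment => c; exact: ler0n.
have iB := integrable_nat_rv pairs_below_ge0 second_factorial_moment.
have sqE : (\int[P]_t ((A t)%:R * (A t)%:R)%:E)%E = (2 * beta + mu)%:E.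
  under eq_integral => t _ do rewrite -expr2 pairs_belowE EFinD EFinM.
  rewrite integralD //=; last by apply: integrableZl.
  by rewrite integralZl // second_factorial_moment first_moment.
have iS : P.-integrable setT (EFin \o (fun t => (A t)%:R * (A t)%:R)).
  by apply: (integrable_nat_rv (f := fun c => c%:R * c%:R)) sqE => c; rewrite mulr_ge0.
rewrite /variance covarianceE; try exact/Lfun1_integrable.
by rewrite pgf_expectation unlock /= sqE -EFinD expr2.
Qed.

End MomentsFromPgf.

Section AlimMoments.
Context {d : measure_display} {T : measurableType d} {R : realType}.
Variable P : probability T R.
Variables (N : nat -> T -> nat) (Z : nat -> nat -> nat -> T -> nat).
Hypothesis HN : forall l : nat, (0 < l)%N -> poisson_law P (N l) (l%:R)^-1.
Hypothesis HZ : forall l r q : nat, (0 < l)%N -> (0 < r)%N -> (0 < q)%N ->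
  poisson_law P (Z l r q) (q%:R)^-1.
Hypothesis Hind : mutually_independent P limit_index_ok (limit_family N Z).
Local Open Scope classical_set_scope.
Variable i : nat.
Hypothesis i0 : (0 < i)%N.

(** The exponent of [iterated_exp] when only the weight at [i] differs from [1], being [1 - e]: the
    pairs with $lq=i$ survive, and $1/q=l/i$. *)
Definition log_pgf (e : R) : R :=
  \sum_(l <- divisors i) (expR (- e * (l%:R / i%:R)) - 1) / l%:R.

Lemma pgf_Alim1 (e : R) : 0 < e < 1 ->
  mean P (fun t => (1 - e) ^+ Alim N Z i t) = expR (log_pgf e).
Proof.
move=> /andP[e0 e1]; pose s j := if j == i then 1 - e else 1.
have s01 j : 0 <= s j <= 1 by rewrite /s; case: eqP => _; apply/andP; split; lra.
have s1 j : (i < j)%N -> s j = 1 by move=> ij; rewrite /s gtn_eqF.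
have := pgf_Alim HN HZ Hind s01 s1.
rewrite (_ : (fun t => \prod_(1 <= j < i.+1) s j ^+ Alim N Z j t) =
  (fun t => (1 - e) ^+ Alim N Z i t)) => [->|]; last first.
  apply/funext => t; rewrite big_nat_recr //= /s eqxx big1_seq ?mul1r // => j.
  rewrite mem_index_iota => /andP[_ /andP[_ ji]].
  by rewrite ltn_eqF ?expr1n.
have im : (0 < i <= i)%N by rewrite i0 leqnn.
rewrite /iterated_exp; congr expR; rewrite /log_pgf (perm_big _ (divisors_filter im)) /=.
rewrite big_filter [RHS]big_mkcond [RHS]big_add1 /= [RHS]big_mkord; apply: eq_bigr => l _.
case: ifP => li; last first.
  rewrite big1 ?expR0 ?subrr ?mul0r // => q _; rewrite /s; case: eqP => [E|_].
    by move: li; rewrite (_ : (l.+1 %| i)%N) //; apply/dvdnP; exists q.+1; rewrite mulnC.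
  by rewrite subrr mul0r.
congr ((expR _ - 1) / _).
have l0 : l.+1%:R != 0 :> R by rewrite pnatr_eq0.
have q0 : (0 < i %/ l.+1)%N by rewrite divn_gt0 // dvdn_leq.
have qi : ((i %/ l.+1).-1 < i)%N by rewrite prednK // leq_div.
have E q : (l.+1 * q.+1 == i)%N = (q == (i %/ l.+1).-1)%N.
  have G a b : (0 < a)%N -> (a %| b)%N -> (0 < b %/ a)%N ->
      (a * q.+1 == b)%N = (q == (b %/ a).-1)%N.
    move=> a0 ab ba; apply/eqP/eqP => [<-|->]; first by rewrite mulKn.
    by rewrite prednK // mulnC divnK.
  exact: G.
rewrite (bigD1 (Ordinal qi)) //= big1 => [|q qne].
  rewrite addr0 /s E eqxx prednK // addrAC subrr add0r.
  have -> : i%:R = (i %/ l.+1)%:R * l.+1%:R :> R by rewrite -natrM divnK.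
  have q1 : (i %/ l.+1)%:R != 0 :> R by rewrite pnatr_eq0 -lt0n.
  by field; rewrite q1 addrC natr1 l0.
rewrite /s E (_ : (q == _ :> nat) = false) ?subrr ?mul0r //.
by apply: contraNF qne => /eqP qE; apply/eqP/val_inj.
Qed.

Let mu : R := (sigma0 i)%:R / i%:R.
Let kappa : R := (i%:R)^-1 * \sum_(l <- divisors i) (l%:R)^-1.

(** The involution $l\mapsto i/l$ on divisors: $(l/i)^2/l=\frac1i\cdot\frac1{i/l}$. *)
Lemma sum_divisors_inv : \sum_(l <- divisors i) (l%:R / i%:R) ^+ 2 / l%:R = kappa.
Proof.
rewrite /kappa mulr_sumr.
have invK l : (l %| i)%N -> (i %/ (i %/ l))%N = l.
  by move=> li; rewrite -{1}(divnK li) mulKn // divn_gt0 ?(dvdn_gt0 i0) // dvdn_leq.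
have pl : perm_eq (divisors i) [seq (i %/ l)%N | l <- divisors i].
  apply: uniq_perm; first exact: divisors_uniq.
    rewrite map_inj_in_uniq ?divisors_uniq // => a b.
    by rewrite -!dvdn_divisors // => ai bi E; rewrite -(invK a ai) E invK.
  move=> l; rewrite -dvdn_divisors //; apply/idP/mapP => [li|[a]].
    by exists (i %/ l)%N; rewrite ?invK // -dvdn_divisors // dvdn_div.
  by rewrite -dvdn_divisors // => ai ->; rewrite dvdn_div.
rewrite [RHS](perm_big _ pl) /= big_map; apply: eq_big_seq => l.
rewrite -dvdn_divisors // => li; have l0 := dvdn_gt0 i0 li.
have q0 : (0 < i %/ l)%N by rewrite divn_gt0 // dvdn_leq.
have -> : i%:R = (i %/ l)%:R * l%:R :> R by rewrite -natrM divnK.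
by field; rewrite !pnatr_eq0 -!lt0n l0 q0.
Qed.

Lemma cvg_harm_ratio (c : R) : - harm n * c / harm n @[n --> \oo] --> - c.
Proof.
rewrite (_ : (fun n => _) = (fun=> - c)); first exact: cvg_cst.
by apply/funext => n; field; rewrite gt_eqF ?harm_gt0.
Qed.

Let h n := log_pgf (harm n).

Lemma mu_sum : \sum_(l <- divisors i) (l%:R / i%:R) / l%:R = mu.
Proof.
rewrite (eq_big_seq (fun=> (i%:R)^-1)) => [|l]; last first.
  rewrite -dvdn_divisors // => /(dvdn_gt0 i0) l0.
  by field; rewrite !pnatr_eq0 -!lt0n i0 l0.
by rewrite big_const_seq count_predT iter_addr_0 /mu /sigma0 mulr_natl.
Qed.

(** The linear terms add up to [- mu * harm n] by [mu_sum]; each divisor leaves the quadratic term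
    $(l/i)^2/(2l)$. *)
Lemma cvg_log_pgf2 : (h n + mu * harm n) / harm n ^+ 2 @[n --> \oo] --> kappa / 2.
Proof.
rewrite -sum_divisors_inv mulr_suml.
rewrite (_ : (fun n => _) = (fun n => \sum_(l <- divisors i)
  ((expR (- harm n * (l%:R / i%:R)) - 1 - (- harm n * (l%:R / i%:R))) / harm n ^+ 2) / l%:R)).
  apply: cvg_big => [|l _]; first exact: add_continuous.
  rewrite mulrAC; apply: cvgMl; rewrite -sqrrN.
  apply: (@expR_second_order _ (fun n => - harm n * (l%:R / i%:R)) harm).
  - exact: harm_gt0.
  - exact: cvg_harm.
  - exact: cvg_harm_ratio.
apply/funext => n; rewrite /h /log_pgf -mu_sum mulr_suml -big_split /= mulr_suml.
apply: eq_big_seq => l; rewrite -dvdn_divisors // => /(dvdn_gt0 i0) l0.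
by field; rewrite (gt_eqF (harm_gt0 n)) !pnatr_eq0 -!lt0n i0 l0.
Qed.

Lemma cvg_log_pgf1 : h n / harm n @[n --> \oo] --> - mu.
Proof.
rewrite (_ : (fun n => _) = (fun n => (h n + mu * harm n) / harm n ^+ 2 * harm n - mu)).
  have c : (h n + mu * harm n) / harm n ^+ 2 * harm n @[n --> \oo] --> kappa / 2 * 0.
    by apply: cvgM; [exact: cvg_log_pgf2|exact: cvg_harm].
  have : (h n + mu * harm n) / harm n ^+ 2 * harm n - mu @[n --> \oo] --> kappa / 2 * 0 - mu.
    by apply: cvgB c _; exact: cvg_cst.
  by rewrite mulr0 sub0r.
by apply/funext => n; field; rewrite gt_eqF ?harm_gt0.
Qed.

(** The logarithm contributes [kappa / 2] and the outer exponential [mu ^+ 2 / 2]; in the variance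
    $2\beta+\mu-\mu^2$ the squares cancel. *)
Lemma cvg_pgf2 : (expR (h n) - 1 + mu * harm n) / harm n ^+ 2 @[n --> \oo] -->
  (kappa + mu ^+ 2) / 2.
Proof.
rewrite (_ : (fun n => _) = (fun n => (h n + mu * harm n) / harm n ^+ 2 +
   (expR (h n) - 1 - h n) / harm n ^+ 2)); last first.
  by apply/funext => n; field; rewrite gt_eqF ?harm_gt0.
rewrite mulrDl; apply: cvgD; first exact: cvg_log_pgf2.
rewrite -sqrrN; apply: (@expR_second_order _ h harm).
- exact: harm_gt0.
- exact: cvg_harm.
- exact: cvg_log_pgf1.
Qed.

Lemma cvg_pgf1 : (1 - expR (h n)) / harm n @[n --> \oo] --> mu.
Proof.
rewrite (_ : (fun n => _) = (fun n => mu -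
  (expR (h n) - 1 + mu * harm n) / harm n ^+ 2 * harm n)).
  have c : (expR (h n) - 1 + mu * harm n) / harm n ^+ 2 * harm n @[n --> \oo] -->
      (kappa + mu ^+ 2) / 2 * 0.
    by apply: cvgM; [exact: cvg_pgf2|exact: cvg_harm].
  have : mu - (expR (h n) - 1 + mu * harm n) / harm n ^+ 2 * harm n @[n --> \oo] -->
      mu - (kappa + mu ^+ 2) / 2 * 0.
    by apply: cvgB _ c; exact: cvg_cst.
  by rewrite mulr0 subr0.
by apply/funext => n; field; rewrite gt_eqF ?harm_gt0.
Qed.

Lemma Alim_moments :
  ('E_P[fun t => (Alim N Z i t)%:R] = mu%:E)%E /\
  ('V_P[fun t => (Alim N Z i t)%:R] = (mu + kappa)%:E)%E.
Proof.
have mA : nat_rv (Alim N Z i) by exact: (nat_rv_Alim HN HZ).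
have gE n : mean P (fun t => (1 - harm n) ^+ Alim N Z i t) = expR (h n).
  by rewrite pgf_Alim1 // harm_gt0 harm_lt1.
have g1 : (1 - mean P (fun t => (1 - harm n) ^+ Alim N Z i t)) / harm n @[n --> \oo] --> mu.
  by under eq_fun do rewrite gE; exact: cvg_pgf1.
have g2 : (mean P (fun t => (1 - harm n) ^+ Alim N Z i t) - 1 + mu * harm n) / harm n ^+ 2
    @[n --> \oo] --> (kappa + mu ^+ 2) / 2.
  by under eq_fun do rewrite gE; exact: cvg_pgf2.
split; first exact: (pgf_expectation mA g1).
by rewrite (pgf_variance mA g1 g2); congr (_%:E); field.
Qed.

End AlimMoments.

Local Open Scope classical_set_scope.

Theorem mainTheorem8
  (R : realType) (d : measure_display) (T : measurableType d)
  (P : probability T R)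
  (N : nat -> T -> nat) (Z : nat -> nat -> nat -> T -> nat)
  (HN : forall l : nat, (0 < l)%N -> poisson_law P (N l) (l%:R)^-1)
  (HZ : forall l r q : nat, (0 < l)%N -> (0 < r)%N -> (0 < q)%N ->
          poisson_law P (Z l r q) (q%:R)^-1)
  (Hind : mutually_independent P limit_index_ok (limit_family N Z)) :
  (* convergence of finite-dimensional distributions as k, n -> oo jointly *)
  (forall (m : nat) (c : nat -> nat) (e : R), 0 < e ->
     exists K : nat, forall k n : nat, (K <= k)%N -> (K <= n)%N ->
       `| wreath_prob k n m c
          - fine (P [set t | forall i : 'I_m, Alim N Z i.+1 t = c i.+1]) | < e)
  (* second expression for A_i *)
  /\ (forall (i : nat) (t : T), (0 < i)%N ->
        exists M : nat, forall M' : nat, (M <= M')%N ->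
          Alim N Z i t
          = (\sum_(l <- divisors i) \sum_(1 <= j < M') j * Xlim N Z l (i %/ l) j t)%N)
  (* for fixed l, q: (X_{l,q,j})_{j>=1} independent, X_{l,q,j} ~ Poi(p^q_j / l) *)
  /\ (forall l q : nat, (0 < l)%N -> (0 < q)%N ->
        mutually_independent P (fun j : nat => (0 < j)%N) (Xlim N Z l q)
        /\ forall j : nat, (0 < j)%N ->
             poisson_law P (Xlim N Z l q j) (pqj q j / l%:R))
  (* the families indexed by different l are independent *)
  /\ independent_families P (fun l : nat => (0 < l)%N)
        (fun p : nat * nat => (0 < p.1)%N && (0 < p.2)%N)
        (fun l p => Xlim N Z l p.1 p.2)
  (* mean and variance *)
  /\ (forall i : nat, (0 < i)%N ->
        ('E_P[fun t => (Alim N Z i t)%:R] = ((sigma0 i)%:R / i%:R)%:E)%E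
        /\ ('V_P[fun t => (Alim N Z i t)%:R]
            = ((sigma0 i)%:R / i%:R
               + (i%:R)^-1 * \sum_(l <- divisors i) (l%:R)^-1)%:E)%E).
Proof.
split; [|split; [|split; [|split]]].
- move=> m c e e0; have /cvgr0_norm_lt := wreath_prob_cvg HN HZ Hind m c.
  (* A set of the product filter contains a rectangle; the larger of its two thresholds serves for
     both [k] and [n]. *)
  move=> /(_ _ e0) [[A B] [/= [a _ aA] [b _ bB]] AB]; exists (maxn a b) => k n.
  rewrite !geq_max => /andP[ak _] /andP[_ bn].
  by apply: (AB (k, n)); split; [exact: aA|exact: bB].
- exact: Alim_by_values.
- move=> l q l0 q0; split=> [|j _]; first exact: (Xlim_independent HN HZ Hind).
  exact: (Xlim_poisson HN HZ Hind).
- exact: (Xlim_blocks_independent HN HZ Hind).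
- by move=> i i0; exact: (Alim_moments HN HZ Hind i0).
Qed.
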